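(* Consider the infinite-frame cancel-on-completion model with arrival rate parameter $\lambda$ and class probability distribution $\pi=(\pi_j)$, where the finite set of classes $j$ includes, together with each class, all its sub-classes (some or all of which may have zero probability under $\pi$). Suppose there exist other parameters $\hat\lambda$ and $\hat\pi=(\hat\pi_j)$ (a probability distribution on the same set of classes) such that: (a) $\hat\pi_j>0$ for all classes and sub-classes; (b) $\lambda\pi_j<\hat\lambda\hat\pi_j$ for all classes and sub-classes $j$; (c) for the parameters $\hat\lambda$ and $\hat\pi$ there exists an infinite-frame DE-FP $\hat x\ne x^{**}$. Then the following uniqueness condition holds for this $\lambda$ (and $\pi$): for any sufficiently small $b\ge0$ there is at most one DE-FP $x$ (for $(\lambda,\pi)$) with infinite frame and $x_\infty=b$.
   Context: Job classes. Class $j$ has integers $1\le k_j\le d_j$ and an exchangeable distribution $F_j$ on $\mathbb R_+^{d_j}$ of its component sizes $(\xi^{(j)}_1,\ldots,\xi^{(j)}_{d_j})$. For an integer $0\le m\le d_j$, the sub-class $j^m$ is the class with parameters $k_j\wedge m$, $d_j\wedge m=m$ and component size distribution equal to the projection of $F_j$ on the first $m$ coordinates ($m=0$: empty sub-class, whose jobs have no effect; $j^{d_j}=j$). Placement rule (cancel-on-completion): if a class $j$ job is placed on $d_j$ servers with workloads $W_1,\dots,W_{d_j}\in[0,\infty]$, and $T$ is the $k_j$-th smallest of $W_i+\xi^{(j)}_i$, then the workload of server $i$ becomes $\max\{W_i,\min\{W_i+\xi^{(j)}_i,T\}\}$ (infinite workloads stay infinite). Standing assumptions: $0<\mathbb E\xi^{(j)}_1<\infty$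 for all non-empty classes $j$; some class $j$ with $\pi_j>0$ satisfies $\mathbb P\{\sum_i \mathbf 1(\xi^{(j)}_i=0)\ge k_j\}<1$. $\mathcal X$ is the set of non-increasing right-continuous $x=(x_w,w\ge0)$ with values in $[0,1]$ (complementary distribution functions on $[0,\infty]$); $x_\infty=\lim_{w\to\infty}x_w$; $x^{**}\equiv1$. The frame size of $x$ is $\min\{w:x_w=0\}$, or $\infty$ (infinite frame) if $x_w>0$ for all $w<\infty$. DE-FP for parameters $(\lambda,\pi)$. For $x\in\mathcal X$, $w\ge0$, let $h(x_{[0,w]})=h^{\pi}(x_{[0,w]})$ be the expected number of servers whose workload passes from $\le w$ to $>w$ when a job, of class $j$ chosen with probability $\pi_j$, is placed by the cancel-on-completion placement rule on $d_j$ servers whose workloads are i.i.d. with $\mathbb P\{W>u\}=x_u$; it depends only on $(x_u,0\le u\le w)$. Let $\alpha=\lambda\sum_j\pi_jd_j$. An element $x\in\mathcal X$ with frame size $c\in[0,\infty]$ is a DE-FP if $w\mapsto x_w$ is $\alpha$-Lipschitz and $-x'_w=\lambda h(x_{[0,w]})$ at every $w\in(0,c)$ where the derivative exists. *)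

(* Defs.v *)
From HB Require Import structures.
From mathcomp Require Import all_boot all_order all_algebra all_fingroup.
From mathcomp Require Import all_classical all_reals all_analysis.
From mathcomp Require Import measurable_realfun.
Import Order.TTheory GRing.Theory Num.Theory.
Import numFieldNormedType.Exports.

Set Implicit Arguments.
Unset Strict Implicit.
Unset Printing Implicit Defensive.

Local Open Scope classical_set_scope.
Local Open Scope ring_scope.

Section IidLaw.
Context d (T : measurableType d) (R : realType).

Definition tuple_cons n (p : T * n.-tuple T) : n.+1.-tuple T :=
  [tuple of p.1 :: p.2].

Lemma measurable_tuple_cons n : measurable_fun setT (@tuple_cons n).
Proof.
exact: (@measurable_cons _ _ _ _ (fst : T * n.-tuple T -> T) n snd).
Qed.

HB.instance Definition _ n := isMeasurableFun.Build _ _ _ _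
  (@tuple_cons n) (@measurable_tuple_cons n).

Fixpoint iid_law (mu : probability T R) (n : nat) :
    probability (n.-tuple T) R :=
  match n with
  | 0 => \d_ [tuple]
  | n'.+1 =>
      distribution (mu \x iid_law mu n')%E (@tuple_cons n')
  end.

Lemma iid_law_box (mu : probability T R) n (A : 'I_n -> set T) :
  (forall i, measurable (A i)) ->
  iid_law mu n [set v | forall i, A i (tnth v i)] = (\prod_i mu (A i))%E.
Proof.
elim: n A => [|n IHn] A mA /=.
  rewrite big_ord0 (_ : [set _ | _] = setT) ?probability_setT//.
  by apply/seteqP; split => // v _ [].
rewrite big_ord_recl -IHn; last by move=> i; exact: mA.
rewrite -product_measure1E//; last first.
  rewrite (_ : [set _ | _] =
      \bigcap_(i in [set: 'I_n]) (@tnth n T ^~ i @^-1` A (lift ord0 i))).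
    by apply: fin_bigcap_measurable => // i _; rewrite -[X in measurable X]setTI;
      exact: measurable_tnth.
  by apply/seteqP; split => v /= Hv i; [move=> _|]; exact: Hv.
rewrite /distribution/= /pushforward/=; congr (product_measure1 _ _ _).
apply/seteqP; split => -[a v] /= => [Hv|[Ha Hv] i].
  split=> [|i]; first by have := Hv ord0; rewrite tnth0.
  by have := Hv (lift ord0 i); rewrite tnthS.
by case: (unliftP ord0 i) => [j ->|->]; rewrite ?tnthS ?tnth0.
Qed.

End IidLaw.

(* Job classes. The component size distribution is a law on R^d; that it is
   carried by the nonnegative orthant is part of [valid_class]. *)
Record job_class (R : realType) := JobClass {
  needed : nat;
  width : nat;
  size_law : probability (width.-tuple R) R }.

Section JobClasses.
Context (R : realType).
Implicit Type c : job_class R.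

Definition permute_coords n (s : 'S_n) (t : n.-tuple R) : n.-tuple R :=
  [tuple tnth t (s i) | i < n].

Definition exchangeable n (F : probability (n.-tuple R) R) : Prop :=
  forall s : 'S_n, forall A : set (n.-tuple R), measurable A ->
    F (permute_coords s @^-1` A) = F A.

(* The alternative [width c = 0] is the empty class. *)
Definition valid_class c : Prop :=
  [/\ (0 < needed c <= width c)%N \/ (needed c = 0%N /\ width c = 0%N),
      exchangeable (size_law c) &
      size_law c [set t | forall i, 0 <= tnth t i] = 1%E].

Definition proj_tuple n (m : 'I_n.+1) (t : n.-tuple R) : m.-tuple R :=
  [tuple tnth t (widen_ord (leq_ord m) i) | i < m].

Lemma measurable_proj_tuple n (m : 'I_n.+1) :
  measurable_fun setT (@proj_tuple n m).
Proof.
apply/measurable_fun_tnthP => i.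
rewrite (_ : _ \o _ = @tnth n R ^~ (widen_ord (leq_ord m) i)).
  exact: measurable_tnth.
by apply/funext => t /=; rewrite tnth_mktuple.
Qed.

HB.instance Definition _ n (m : 'I_n.+1) := isMeasurableFun.Build _ _ _ _
  (@proj_tuple n m) (@measurable_proj_tuple n m).

Definition sub_class c (m : 'I_(width c).+1) : job_class R :=
  @JobClass R (minn (needed c) m) m
    (distribution (size_law c) (@proj_tuple (width c) m)).

Definition mean_size c : \bar R := \int[size_law c]_t (t`_0)%:E.

Definition prob_enough_zeros c : \bar R :=
  size_law c [set t | (needed c <= \sum_(i < width c) (tnth t i == 0%R))%N].

Definition kth_smallest (k : nat) (s : seq (\bar R)) : \bar R :=
  nth +oo%E (sort <=%O s) k.-1.

Section Placement.
Context (k n : nat) (W : n.-tuple (\bar R)) (xi : n.-tuple R).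

Definition completion_level : \bar R :=
  kth_smallest k [seq (tnth W i + (tnth xi i)%:E)%E | i : 'I_n].

Definition new_workload (i : 'I_n) : \bar R :=
  maxe (tnth W i) (mine (tnth W i + (tnth xi i)%:E)%E completion_level).

Definition crossings (w : R) : nat :=
  (\sum_(i < n) ((tnth W i <= w%:E)%E && (w%:E < new_workload i)%E))%N.

End Placement.

End JobClasses.

Section Workload.
Context (R : realType).
Implicit Type x : R -> R.

(* Elements of the space X are functions on [0, +oo[; they are represented by
   functions on R whose values at negative reals are irrelevant. *)
Definition in_X x : Prop :=
  [/\ {in `[0, +oo[ &, {homo x : u v / u <= v >-> v <= u}},
      (forall w, 0 <= w -> x u @[u --> w^'+] --> x w) &
      (forall w, 0 <= w -> 0 <= x w <= 1)].

(* Law of the workload W with P{W > u} = x_u, obtained by applying the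
   generalized inverse of x to a uniform variable; see [workload_law_tail]. *)
Definition quantile x (u : measurableTypeR R) : \bar R :=
  ereal_inf (EFin @` [set w : R | 0 <= w /\ x w <= u]).

Lemma quantile_nonincreasing x (u v : R) :
  u <= v -> (quantile x v <= quantile x u)%E.
Proof.
move=> uv; apply: ereal_inf_le_tmp => _ [w [w0 xw] <-].
by exists w => //; split=> //; exact: le_trans uv.
Qed.

Lemma measurable_quantile x : measurable_fun setT (quantile x).
Proof.
apply: (measurability _ (ErealGenOInfty.measurableE R)) => _ [_ [r ->] <-].
rewrite setTI; apply: is_interval_measurable => a b /= qa qb c /andP[ac cb].
move: qb; rewrite /= !in_itv/= !andbT => /lt_le_trans; apply.
exact: quantile_nonincreasing.
Qed.

HB.instance Definition _ x := isMeasurableFun.Build _ _ _ _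
  (quantile x) (measurable_quantile x).

Definition workload_law x : probability (\bar R) R :=
  distribution (uniform_prob (@ltr01 R)) (quantile x).

Lemma quantile_gt x (u w : R) : in_X x -> 0 <= w ->
  (w%:E < quantile x u)%E = (u < x w).
Proof.
move=> [xd xr x01] w0; apply/idP/idP => [|uxw].
  apply: contraTT; rewrite -!leNgt => xwu.
  by apply: ereal_inf_lbound; exists w.
have [e /= e0 He] : \forall v \near w^'+, u < x v.
  exact: (cvgr_gt (x w) (xr w w0)).
have lew : ((w + e)%:E <= quantile x u)%E.
  apply: le_ereal_inf_tmp => _ [v [v0 xvu] <-]; rewrite lee_fin leNgt.
  apply/negP => vwe.
  have [vw|wv] := leP v w.
    have := xd v w; rewrite !in_itv/= !andbT => /(_ v0 w0 vw) xwv.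
    by move: (lt_le_trans uxw xwv); rewrite ltNge xvu.
  suff : u < x v by rewrite ltNge xvu.
  by apply: He => //=; rewrite distrC gtr0_norm ?subr_gt0// ltrBlDl.
by apply: lt_le_trans lew; rewrite lte_fin ltrDl.
Qed.

Lemma workload_law_tail x (w : R) : in_X x -> 0 <= w ->
  workload_law x [set W | (w%:E < W)%E] = (x w)%:E.
Proof.
move=> xX w0.
have /andP[xw0 xw1] : 0 <= x w <= 1 by case: xX => _ _; apply.
rewrite /workload_law /distribution/= /pushforward/=.
have -> : quantile x @^-1` [set W | (w%:E < W)%E] = `]-oo, x w[%classic.
  by apply/seteqP; split => u /=; rewrite in_itv/= quantile_gt.
rewrite /uniform_prob integral_uniform_pdf.
have -> : `]-oo, x w[%classic `&` `[0, 1]%classic = `[0, x w[%classic.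
  apply/seteqP; split => u /=; rewrite !in_itv/=.
    by move=> [-> /andP[-> _]].
  by move=> /andP[-> uxw]; rewrite uxw (le_trans (ltW uxw)).
rewrite (eq_integral (cst 1%E)); last first.
  move=> u; rewrite inE/= in_itv/= => /andP[u0 uxw].
  by rewrite /uniform_pdf u0 (le_trans (ltW uxw))//= subr0 invr1.
rewrite integral_cst//= mul1e lebesgue_measure_itv/= lte_fin.
case: ltP => [_|xwle0]; first by rewrite sube0.
by congr EFin; apply/le_anti; rewrite xw0 xwle0.
Qed.

Lemma workload_law_ge0 x : workload_law x [set W | (0 <= W)%E] = 1%E.
Proof.
rewrite /workload_law /distribution/= /pushforward/=.
have -> : quantile x @^-1` [set W | (0 <= W)%E] = setT.
  apply/seteqP; split => // u _ /=.
  by apply: le_ereal_inf_tmp => _ [v [v0 _] <-]; rewrite lee_fin.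
exact: probability_setT.
Qed.

End Workload.

Section DEFP.
Context (R : realType) (J : finType) (cls : J -> job_class R).
Implicit Types (lam w : R) (p : J -> R) (x : R -> R).

Definition is_distribution p : Prop :=
  (forall j, 0 <= p j) /\ \sum_j p j = 1.

(* The servers' workloads are i.i.d. and independent of the component sizes. *)
Definition class_crossings x w (j : J) : \bar R :=
  (\int[size_law (cls j) \x iid_law (workload_law x) (width (cls j))]_z
     (crossings (needed (cls j)) z.2 z.1 w)%:R%:E)%E.

Definition expected_crossings p x w : \bar R :=
  (\sum_j (p j)%:E * class_crossings x w j)%E.

Definition total_load lam p : R :=
  lam * \sum_j p j * (width (cls j))%:R.

(* For x in X the infimum is attained when the set is nonempty, and it is +oo
   when x_w > 0 for all finite w. *)
Definition frame_size x : \bar R :=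
  ereal_inf (EFin @` [set w | 0 <= w /\ x w = 0]).

Definition infinite_frame x : Prop := frame_size x = +oo%E.

Definition is_DEFP lam p x : Prop :=
  [/\ in_X x,
      (total_load lam p).-lipschitz_(`[0, +oo[) x &
      forall w, 0 < w -> (w%:E < frame_size x)%E -> derivable x w 1 ->
        (- 'D_1 x w)%:E = (lam%:E * expected_crossings p x w)%E].

Definition closed_under_sub_classes : Prop :=
  forall j (m : 'I_(width (cls j)).+1), exists i, cls i = sub_class m.

Definition nonempty_classes_mean : Prop :=
  forall j, (0 < width (cls j))%N ->
    (0 < mean_size (cls j))%E /\ (mean_size (cls j) < +oo)%E.

Definition some_class_not_instant p : Prop :=
  exists2 j, 0 < p j & (prob_enough_zeros (cls j) < 1)%E.

End DEFP.

(* Main.v *)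
From HB Require Import structures.
Require Import Defs.
From mathcomp Require Import all_boot all_order all_algebra all_fingroup.
From mathcomp Require Import all_classical all_reals all_analysis.
From mathcomp Require Import measurable_realfun.
From mathcomp Require Import ring lra.
Import Order.TTheory GRing.Theory Num.Theory.
Import numFieldNormedType.Exports.

(* For sizes [xi] fixed, the expected number of crossings of level [w] is a
   polynomial in the numbers [x_(w - xi_i)] and [x_w], where [x] is extended by
   [1] to the negative reals. It is nondecreasing in the [x_(w - xi_i)], so DE-FPs
   obey a maximum principle: if a left shift [y_(. + d)] of a DE-FP lies below a
   strict supersolution, they do not touch, because at a contact point the right
   derivatives are ordered the wrong way. Decreasing [d] to [0] therefore gives
   [y <= z] for a strict supersolution [z] as soon as no contact can occur at
   infinity.

   Let [z] be the DE-FP of the dominating parameters. All single-server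
   sub-classes having extra arrivals, [z] is a supersolution with a slack
   proportional to its own mean increments, so [z + a] is still strict for small
   [a]; hence [x <= z + a] for every DE-FP [x] with [x_oo < a]. Comparing the
   Volterra equations for [-x'] and [-z'] then bounds the increments of [x] by a
   multiple of those of [z], so that far away [x + t q] is a strict
   supersolution, for a suitable [q] with values in [[1, 2]] that increases with
   [z]. Two DE-FPs [x] and [y] with the same limit can thus touch, after an optimal
   shift by [d] of [y], only at finite levels. Such a contact propagates to the
   right by Gronwall's lemma, and if [d > 0] it forces almost all sizes to be [0].
   So [d = 0] and [y <= x]; by symmetry [x = y]. *)

Set Implicit Arguments.
Unset Strict Implicit.
Unset Printing Implicit Defensive.
Local Open Scope classical_set_scope.
Local Open Scope ring_scope.

(** * The crossing polynomial *)

(** Rates vanish at infinity, so a slack is useful only in the unit in which errors are measured.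
    That unit is [total_increments], the mean number of crossings if nothing were cancelled. Raising
    all tails by [b] raises a rate by at most [b * alpha] such units, because the slope of the
    polynomial in each tail is at most the sum of the chances to cross. Conversely a single-server
    job is never cancelled, so by exchangeability its crossings are this unit up to the width of the
    class. This is why the classes are closed under sub-classes and each of them must be strictly
    dominated.

    A shift moves the origin of a DE-FP, but in the favourable direction: where the unshifted tail
    looks below [0] it equals [1], the largest possible value. A shift does not lower the limit, so
    contact at infinity needs an argument of its own.

    The differential equation is given only where the derivative exists, while a contact point
    cannot be chosen. Rates are right-continuous but may jump, since the extended tail jumps at [0].
    Hence everything is phrased with right derivatives, which exist at every level. *)

Section CrossingPolynomial.
Context (R : realFieldType) (I : Type).
Implicit Types (a e : I -> R) (r : seq I) (k : nat).

(* For independent events indexed by [r], the [i]-th failing with probability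
   [a i], [few a r k] is the probability that fewer than [k] of them occur. For
   independent servers, [cross e a r k] is the mean number of crossings when
   server [i] has probability [e i] to be able to cross and probability [1 - a i]
   to complete too early, the crossings being cancelled by [k] completions. *)
Fixpoint few a r k : R :=
  if r is i :: r' then (1 - a i) * few a r' k.-1 + a i * few a r' k
  else (0 < k)%N%:R.

Fixpoint cross e a r k : R :=
  if r is i :: r' then
    (1 - a i) * cross e a r' k.-1 + a i * cross e a r' k + e i * few a r' k
  else 0.

Section Bounds.
Context (a : I -> R) (a01 : forall i, 0 <= a i <= 1).

Lemma few_itv r k : 0 <= few a r k <= 1.
Proof.
elim: r k => [|i r IH] k /=; first by case: k => //=; rewrite ?lexx ler01.
have /andP[? ?] := a01 i.
have /andP[? ?] := IH k; have /andP[? ?] := IH k.-1; apply/andP; split; nra.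
Qed.

Lemma few_pred r k : few a r k.-1 <= few a r k.
Proof.
elim: r k => [|i r IH] k /=; first by case: k => [|[|k]] //=; rewrite ler01.
have /andP[? ?] := a01 i.
by rewrite lerD// ler_wpM2l// ?subr_ge0.
Qed.

Lemma few_ge_expr (m : R) r k : 0 <= m <= 1 -> (forall i, m <= a i) ->
  (0 < k)%N -> m ^+ size r <= few a r k.
Proof.
move=> /andP[m0 m1] ma k0; elim: r => [|i r IH] /=; first by rewrite k0.
have /andP[? ?] := a01 i; have /andP[? _] := few_itv r k.-1.
rewrite exprS; apply: le_trans (_ : a i * few a r k <= _).
  by apply: ler_pM => //; exact: exprn_ge0.
by rewrite lerDr mulr_ge0// subr_ge0.
Qed.

Context (e : I -> R) (e0 : forall i, 0 <= e i).

Lemma cross_bounds r k :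
  0 <= cross e a r k.-1 <= cross e a r k /\ cross e a r k <= \sum_(i <- r) e i.
Proof.
suff H l : 0 <= cross e a r l /\ cross e a r l.-1 <= cross e a r l /\
    cross e a r l <= \sum_(i <- r) e i.
  have [? [? ?]] := H k; have [? _] := H k.-1.
  by split => //; apply/andP.
elim: r l => [|i r IH] l /=; first by rewrite big_nil.
rewrite big_cons.
have /andP[? ?] := a01 i; have ? := e0 i.
have /andP[? ?] := few_itv r l; have ? := few_pred r l.
have [? [? ?]] := IH l; have [? [? ?]] := IH l.-1.
have ? : (1 - a i) * cross e a r l.-1.-1 <= (1 - a i) * cross e a r l.-1.
  by rewrite ler_wpM2l ?subr_ge0.
have ? : a i * cross e a r l.-1 <= a i * cross e a r l by rewrite ler_wpM2l.
have ? : (1 - a i) * cross e a r l.-1 <= (1 - a i) * cross e a r l.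
  by rewrite ler_wpM2l ?subr_ge0.
have ? : 0 <= (1 - a i) * cross e a r l.-1 by rewrite mulr_ge0 ?subr_ge0.
have ? : 0 <= a i * cross e a r l by rewrite mulr_ge0.
have ? : e i * few a r l.-1 <= e i * few a r l by rewrite ler_wpM2l.
have ? : e i * few a r l <= e i by rewrite ler_piMr.
have ? : 0 <= e i * few a r l by rewrite mulr_ge0.
by repeat split; lra.
Qed.

(** A server that can cross does so at least when no other server completes early, which has
    probability at least [m ^+ size r]. This turns gaps between tails into gaps between rates. *)
Lemma cross_ge_sum (m : R) r k : 0 <= m <= 1 -> (forall i, m <= a i) ->
  (0 < k)%N -> m ^+ size r * \sum_(i <- r) e i <= cross e a r k.
Proof.
move=> m01 ma k0; have /andP[m0 m1] := m01.
elim: r => [|i r IH] /=; first by rewrite big_nil mulr0.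
rewrite big_cons exprS.
have /andP[? ?] := a01 i; have ? := e0 i; have ? := ma i.
have [/andP[? ?] ?] := cross_bounds r k.
have ? := few_ge_expr r m01 ma k0.
have ? : 0 <= m ^+ size r by exact: exprn_ge0.
have ? : 0 <= \sum_(j <- r) e j by exact: sumr_ge0.
set p := m ^+ _ in IH *; set S := \sum_(_ <- _) _ in IH *.
have H1 : m * (p * S) <= a i * cross e a r k by apply: ler_pM => //; rewrite mulr_ge0.
have H2 : m * p * e i <= e i * few a r k.
  rewrite mulrC ler_wpM2l//; apply: le_trans (_ : p <= _) => //.
  by rewrite ler_piMl.
have H3 : 0 <= (1 - a i) * cross e a r k.-1 by rewrite mulr_ge0// subr_ge0.
by lra.
Qed.

End Bounds.

(** [few] is affine in each [a i], with a slope of the form [few a r k - few a r k.-1] in [[0, 1]];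
    raising the probabilities by [b] therefore costs at most [b] per server. *)
Lemma few_perturb a a' b r k : (forall i, 0 <= a i <= 1) ->
  (forall i, 0 <= a' i <= 1) -> 0 <= b -> (forall i, a' i <= a i + b) ->
  few a' r k <= few a r k + b * (size r)%:R.
Proof.
move=> a01 a'01 b0 a'a; elim: r k => [|i r IH] k /=; first by rewrite mulr0 addr0.
have /andP[? ?] := a01 i; have /andP[? ?] := a'01 i; have ? := a'a i.
have ? := few_pred a01 r k; have /andP[? ?] := few_itv a01 r k.
have /andP[? ?] := few_itv a01 r k.-1.
have ? := IH k; have ? := IH k.-1.
rewrite -addn1 natrD; set n := (size r)%:R in IH *.
have H1 : (1 - a' i) * few a' r k.-1 <= (1 - a' i) * (few a r k.-1 + b * n).
  by rewrite ler_wpM2l ?subr_ge0.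
have H2 : a' i * few a' r k <= a' i * (few a r k + b * n) by rewrite ler_wpM2l.
have H3 : (a' i - a i) * (few a r k - few a r k.-1) <= b.
  apply: le_trans (_ : b * (few a r k - few a r k.-1) <= _).
    by rewrite ler_wpM2r ?subr_ge0// lerBlDl.
  by rewrite ler_piMr//; lra.
by lra.
Qed.

(** The slope in each [a i] is a difference of two values of [cross], hence at most the sum of the
    [e i]. This factor in the error is what lets a slack proportional to the increments absorb it at
    every level. *)
Lemma cross_perturb e a a' b r k : (forall i, 0 <= a i <= 1) ->
  (forall i, 0 <= a' i <= 1) -> (forall i, 0 <= e i) ->
  0 <= b -> (forall i, a' i <= a i + b) ->
  cross e a' r k <= cross e a r k + b * (size r)%:R * \sum_(i <- r) e i.
Proof.
move=> a01 a'01 e0 b0 a'a; elim: r k => [|i r IH] k /=.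
  by rewrite big_nil mulr0 addr0.
have /andP[? ?] := a01 i; have /andP[? ?] := a'01 i; have ? := a'a i.
have ? := e0 i; have ? := few_perturb r k a01 a'01 b0 a'a.
have [/andP[? ?] ?] := cross_bounds a01 e0 r k.
have ? := IH k; have ? := IH k.-1.
rewrite big_cons -addn1 natrD; set n := (size r)%:R in IH *.
have ? : 0 <= n by exact: ler0n.
have H1 : (1 - a' i) * cross e a' r k.-1 <= (1 - a' i) * (cross e a r k.-1 + b * n * \sum_(j <- r) e j).
  by rewrite ler_wpM2l ?subr_ge0.
have H2 : a' i * cross e a' r k <= a' i * (cross e a r k + b * n * \sum_(j <- r) e j) by rewrite ler_wpM2l.
have H3 : e i * few a' r k <= e i * (few a r k + b * n) by rewrite ler_wpM2l.
have H4 : (a' i - a i) * (cross e a r k - cross e a r k.-1) <= b * \sum_(j <- r) e j.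
  apply: le_trans (_ : b * (cross e a r k - cross e a r k.-1) <= _).
    by rewrite ler_wpM2r ?subr_ge0// lerBlDl.
  by rewrite ler_wpM2l//; lra.
have H5 : 0 <= b * e i by rewrite mulr_ge0.
have H6 : 0 <= b * n * e i by rewrite !mulr_ge0.
by lra.
Qed.

Lemma cross_linear e1 e2 (s : R) a r k :
  cross (fun i => e1 i + s * e2 i) a r k = cross e1 a r k + s * cross e2 a r k.
Proof. by elim: r k => [|i r IH] k /=; rewrite ?IH; ring. Qed.

Lemma eq_cross e e' a a' r k : e =1 e' -> a =1 a' ->
  cross e a r k = cross e' a' r k.
Proof.
move=> ee aa; have fewE l s : few a s l = few a' s l.
  by elim: s l => //= i s IH l; rewrite !IH aa.
by elim: r k => //= i r IH k; rewrite !IH fewE ee aa.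
Qed.

Lemma cross_monotone e1 e2 a r k : (forall i, 0 <= a i <= 1) ->
  (forall i, e1 i <= e2 i) -> cross e1 a r k <= cross e2 a r k.
Proof.
move=> a01 ee; rewrite -subr_ge0.
have := cross_linear e2 e1 (-1) a r k; rewrite mulN1r => <-.
have e0 i : 0 <= e2 i + -1 * e1 i by have := ee i; lra.
by have [/andP[+ ?] _] := cross_bounds a01 e0 r k.+1.
Qed.

(** There are two reference functions because the supersolution used far away combines a DE-FP with
    a multiple of the dominating one. *)
Lemma cross_compare e e1 e2 a a1 a2 (C1 C2 b1 b2 : R) r k :
  (forall i, 0 <= a i <= 1) -> (forall i, 0 <= a1 i <= 1) ->
  (forall i, 0 <= a2 i <= 1) -> (forall i, 0 <= e1 i) -> (forall i, 0 <= e2 i) ->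
  0 <= C1 -> 0 <= C2 -> 0 <= b1 -> 0 <= b2 ->
  (forall i, e i <= C1 * e1 i + C2 * e2 i) ->
  (forall i, a i <= a1 i + b1) -> (forall i, a i <= a2 i + b2) ->
  cross e a r k <=
    C1 * (cross e1 a1 r k + b1 * (size r)%:R * \sum_(i <- r) e1 i) +
    C2 * (cross e2 a2 r k + b2 * (size r)%:R * \sum_(i <- r) e2 i).
Proof.
move=> a01 a101 a201 e10 e20 C10 C20 b10 b20 ee aa1 aa2.
apply: le_trans (_ : cross (fun i => (0 + C1 * e1 i) + C2 * e2 i) a r k <= _).
  by apply: cross_monotone => // i; rewrite add0r.
rewrite (cross_linear (fun i => 0 + C1 * e1 i)) (cross_linear (fun=> 0)).
rewrite (_ : cross (fun=> 0) _ _ _ = 0); last first.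
  by elim: r k => //= i r IH k; rewrite !IH; ring.
by rewrite add0r; apply: lerD; rewrite ler_wpM2l//; exact: cross_perturb.
Qed.

(** This is the case of ordered tails over levels that differ by [c]: the chances to cross grow by
    at most [c] each. It yields the linear bound needed for Gronwall's lemma along a contact. *)
Lemma cross_add_cst e e' a a' (c : R) r k : (forall i, 0 <= a i <= 1) ->
  (forall i, 0 <= a' i <= 1) -> (forall i, 0 <= e' i) -> 0 <= c ->
  (forall i, e i <= e' i + c) -> (forall i, a i <= a' i) ->
  cross e a r k <= cross e' a' r k + c * (size r)%:R.
Proof.
move=> a01 a'01 e'0 c0 ee aa.
apply: le_trans (_ : cross (fun i => e' i + c * 1) a r k <= _).
  by apply: cross_monotone => // i; rewrite mulr1.
rewrite (cross_linear e'); apply: lerD.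
  have := @cross_perturb e' a' a 0 r k a'01 a01 e'0 (lexx _).
  by rewrite !mul0r addr0; apply => i; rewrite addr0.
rewrite ler_wpM2l//.
have [_ H] := @cross_bounds a a01 (fun=> 1) (fun=> ler01) r k.
apply: le_trans H _.
by rewrite big_const_seq count_predT iter_addr_0.
Qed.

End CrossingPolynomial.

(** * Lipschitz functions and right derivatives *)

Section Rademacher.
Context (R : realType).
Notation mu := (@lebesgue_measure R).

Lemma stieltjes_measure_itv (F : cumulative R R) (u v : R) : u <= v ->
  lebesgue_stieltjes_measure F `]u, v] = (F v - F u)%:E.
Proof.
move=> uv; rewrite /lebesgue_stieltjes_measure /measure_extension.
rewrite measurable_mu_extE/=; last exact: is_ocitv.
by rewrite wlength_itv_bnd.
Qed.

Lemma lipschitz_continuous (F : R -> R) (L : R) : 0 < L ->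
  (forall u v, u <= v -> `|F v - F u| <= L * (v - u)) -> continuous F.
Proof.
move=> L0 lF x; apply/cvgrPdist_le => e e0; near=> t.
have [xt|tx] := leP x t.
  rewrite distrC (le_trans (lF _ _ xt))// -ler_pdivlMl//.
  apply: le_trans (ler_norm _) _; rewrite distrC.
  by near: t; apply: cvgr_dist_le => //; rewrite mulr_gt0 ?invr_gt0.
rewrite (le_trans (lF _ _ (ltW tx)))// -ler_pdivlMl//.
apply: le_trans (ler_norm _) _.
by near: t; apply: cvgr_dist_le => //; rewrite mulr_gt0 ?invr_gt0.
Unshelve. all: by end_near. Qed.

(** [G w = L * w - F w] is nondecreasing as well, and the measures of [F] and [G] add up to [L]
    times Lebesgue measure; a Lebesgue null set is thus null for both. *)
Lemma stieltjes_dominates (F : cumulative R R) (L : R) : 0 < L ->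
  (forall u v, u <= v -> F v - F u <= L * (v - u)) ->
  lebesgue_stieltjes_measure F `<< mu.
Proof.
move=> L0 lF.
have ndF := cumulative_is_nondecreasing F.
pose G (w : R) := L * w - F w.
have ndG : nondecreasing G.
  move=> u v uv; rewrite /G; have := lF _ _ uv; lra.
have rcG : right_continuous G.
  move=> x; apply: cvgB; last exact: cumulative_is_right_continuous.
  apply: cvgMr; exact: cvg_within.
pose G' : cumulative R R := HB.pack G (isCumulative.Build R _ R G ndG rcG).
pose nu := measure_add (lebesgue_stieltjes_measure F)
  (lebesgue_stieltjes_measure G').
have nuE X : nu X = (lebesgue_stieltjes_measure F X +
    lebesgue_stieltjes_measure G' X)%E by rewrite /nu measure_addE.
have L'0 : 0 <= L^-1 by rewrite invr_ge0 ltW.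
have muE A : measurable A -> mu A = mscale (NngNum L'0) nu A.
  apply: lebesgue_measure_unique => X /ocitvP[->|[[u v] /= uv ->]].
    by rewrite !measure0.
  transitivity ((L^-1)%:E * nu `]u, v]%classic)%E; last by [].
  rewrite nuE !stieltjes_measure_itv ?(ltW uv)//.
  rewrite lebesgue_measure_itv/= lte_fin uv -!EFinD -EFinM; congr EFin.
  rewrite /G /=; field; exact: lt0r_neq0.
apply/null_content_dominatesP => A mA mA0.
have : nu A = 0%E.
  have : ((L^-1)%:E * nu A = 0)%E by apply: etrans mA0; exact/esym/muE.
  move=> /eqP; rewrite mule_eq0 eqe invr_eq0.
  by rewrite gt_eqF//= => /eqP.
rewrite nuE => /eqP.
by rewrite padde_eq0 ?measure_ge0// => /andP[/eqP ->].
Qed.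

(* Lebesgue differentiation of the Radon-Nikodym density of the Stieltjes measure. *)
Lemma lipschitz_increment_bounds (F : R -> R) (L a b m M : R) : 0 < L ->
  {homo F : u v / u <= v} ->
  (forall u v, u <= v -> F v - F u <= L * (v - u)) -> a <= b -> 0 <= m ->
  (forall v, a < v < b -> derivable F v 1 -> m <= 'D_1 F v <= M) ->
  m * (b - a) <= F b - F a <= M * (b - a).
Proof.
move=> L0 ndF lF ab m0 dF.
have cF : continuous F.
  apply: (@lipschitz_continuous F L) => // u v uv.
  by rewrite ger0_norm ?subr_ge0 ?ndF//; exact: lF.
have rcF : right_continuous F.
  by move=> x; apply: cvg_within_filter; exact: cF.
pose F' : cumulative R R := HB.pack F (isCumulative.Build R _ R F ndF rcF).
pose nu := lebesgue_stieltjes_measure F'.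
have nuE u v : u <= v -> nu `]u, v]%classic = (F v - F u)%:E.
  by move=> uv; rewrite /nu stieltjes_measure_itv.
pose D : set (measurableTypeR R) := `]a, b]%classic.
have mD : measurable D by exact: measurable_itv.
have nuD : (nu D < +oo)%E by rewrite nuE// ltry.
have [|f [f0 ffin intf fE]] :=
    @radon_nikodym_sigma_finite _ _ R mu (mfrestr mD nuD).
  apply/null_content_dominatesP => A mA mA0.
  have := stieltjes_dominates (F := F') L0 lF.
  move=> /null_content_dominatesP/(_ _ mA mA0) nuA0.
  apply/eqP; rewrite eq_le measure_ge0 andbT -nuA0 /= /mfrestr /mrestr.
  by apply: le_measure; rewrite ?inE//; exact: measurableI.
pose phi := fine \o f.
have fphi : f = EFin \o phi by apply/funext => x; rewrite /= /phi/= fineK.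
have intphi : mu.-integrable setT (EFin \o phi) by rewrite -fphi.
have FE x : a < x <= b -> F x = F a + \int[mu]_(t in `]a, x]) phi t.
  move=> /andP[ax xb]; apply/eqP; rewrite addrC -subr_eq; apply/eqP.
  apply: EFin_inj; rewrite -nuE ?(ltW ax)//.
  have -> : nu `]a, x]%classic = mfrestr mD nuD `]a, x]%classic.
    rewrite /mfrestr /mrestr /= setIidl//.
    by apply: subset_itvl; rewrite bnd_simp.
  rewrite fE// /Rintegral fineK; first by rewrite fphi.
  apply: integrable_fin_num => //; exact: integrableS intphi.
have intphiy y : mu.-integrable [set` Interval (BRight a) (BRight y)] (EFin \o phi).
  exact: integrableS intphi.
have locphi : locally_integrable [set: R] phi.
  by apply: open_integrable_locally => //; exact: openT.
have aeD : {ae mu, forall x, D x -> (m%:E <= f x <= M%:E)%E}.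
  have : {ae mu, forall x, x != b}.
    exists [set b]; split => //; first exact: lebesgue_measure_set1.
    by move=> x /= /negP; rewrite negbK => /eqP.
  have := FTC1 intphiy locphi.
  apply: (@filterS2 _ _ (ae_filter_ringOfSetsType mu)) => x Hx xb; rewrite /D/= in_itv/= => /andP[ax].
  rewrite le_eqVlt (negbTE xb)/= => xltb.
  have [dPhi Phix] := Hx ax.
  pose Phi y := \int[mu]_(t in `]a, y]) phi t.
  have nearE : \near x, F a + Phi x = F x.
    near=> y; apply/esym/FE; apply/andP; split.
      by near: y; exact: lt_nbhsr.
    by apply: ltW; near: y; exact: lt_nbhsl.
  have dPhi' : is_derive x 1 Phi (phi x).
    by apply: (DeriveDef dPhi); rewrite -Phix derive1E.
  have dFphi : is_derive x 1 F (phi x).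
    apply: near_eq_is_derive nearE _; rewrite -[phi x]add0r.
    exact: is_deriveD.
  have [dF' vF] : derivable F x 1 /\ 'D_1 F x = phi x by case: dFphi.
  have := dF x; rewrite ax xltb => /(_ isT dF'); rewrite vF => mphiM.
  by rewrite fphi/= !lee_fin.
have [->|aneb] := eqVneq a b; first by rewrite !subrr !mulr0 lexx.
have altb : a < b by rewrite lt_neqAle aneb.
have nuDE : ((F b - F a)%:E = \int[mu]_(x in D) f x)%E.
  rewrite -nuE//; transitivity (mfrestr mD nuD D); last by rewrite fE.
  by rewrite /mfrestr /mrestr /= setIid.
have muD : mu D = (b - a)%:E by rewrite lebesgue_measure_itv/= lte_fin altb.
have mf : measurable_fun D f.
  by apply: measurable_funTS; exact: measurable_int intf.
(* Otherwise [0 <= f x <= M] would fail on all of [D], which has positive measure. *)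
have M0 : 0 <= M.
  have [//|Mneg] := leP 0 M.
  have /negP[] : ~~ (mu D <= 0)%E by rewrite muD -ltNge lte_fin subr_gt0.
  have [N [mN N0 sN]] := aeD.
  rewrite -N0; apply: le_measure; rewrite ?inE// => x Dx; apply: sN => /(_ Dx).
  by move=> /andP[_]; rewrite leNgt (lt_le_trans _ (f0 x))// lte_fin.
rewrite -!lee_fin nuDE; apply/andP; split.
  have -> : ((m * (b - a))%:E = \int[mu]_(x in D) m%:E)%E.
    by rewrite integral_cst// EFinM; congr (_ * _)%E; exact/esym/muD.
  apply: ae_ge0_le_integral => //.
  by apply: (@filterS _ _ (ae_filter_ringOfSetsType mu)) aeD => x H /H /andP[].
have -> : ((M * (b - a))%:E = \int[mu]_(x in D) M%:E)%E.
  by rewrite integral_cst// EFinM; congr (_ * _)%E; exact/esym/muD.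
apply: ae_ge0_le_integral => //.
by apply: (@filterS _ _ (ae_filter_ringOfSetsType mu)) aeD => x H /H /andP[].
Unshelve. all: by end_near. Qed.

End Rademacher.

(** * Right derivatives, continuous induction and contact points *)

Section RightDerivative.
Context (R : realType).
Implicit Types (F G : R -> R) (u v w l m s : R).

(** A DE-FP may fail to be differentiable at a contact point, but the derivative from the right
    exists there and already orders the two rates. *)
Definition right_derivative F w l : Prop :=
  forall e, 0 < e -> exists2 d, 0 < d &
    forall s, 0 <= s <= d -> `|F (w + s) - F w - l * s| <= e * s.

Definition lipschitz_ge u (L : R) F : Prop :=
  forall v w, u <= v <= w -> `|F w - F v| <= L * (w - v).

Lemma right_derivative_linear F G w l m (c : R) :
  right_derivative F w l -> right_derivative G w m ->
  right_derivative (fun v => F v + c * G v) w (l + c * m).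
Proof.
move=> dF dG e e0.
have c0 : 0 < 2 * (`|c| + 1) by have := normr_ge0 c; lra.
have [d1 d10 H1] := dF (e / 2) ltac:(lra).
have [d2 d20 H2] := dG (e / (2 * (`|c| + 1))) ltac:(exact: divr_gt0).
exists (Num.min d1 d2) => [|s /andP[s0]]; first by rewrite lt_min d10.
rewrite le_min => /andP[sd1 sd2].
have /H1 E1 : 0 <= s <= d1 by rewrite s0.
have /H2 E2 : 0 <= s <= d2 by rewrite s0.
have -> : F (w + s) + c * G (w + s) - (F w + c * G w) - (l + c * m) * s =
  (F (w + s) - F w - l * s) + c * (G (w + s) - G w - m * s) by ring.
apply: le_trans (ler_normD _ _) _; rewrite normrM.
have : `|c| * `|G (w + s) - G w - m * s| <= e / 2 * s; last lra.
apply: le_trans (_ : (`|c| + 1) * (e / (2 * (`|c| + 1)) * s) <= _).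
  by apply: ler_pM => //; rewrite lerDl.
rewrite le_eqVlt; apply/orP; left; apply/eqP; field.
by have := normr_ge0 c; apply: contra_leN => /eqP; lra.
Qed.

Lemma right_derivative_shift F w l (c : R) :
  right_derivative F (w + c) l -> right_derivative (fun v => F (v + c)) w l.
Proof.
move=> dF e /dF[d d0 H]; exists d => // s sd.
by rewrite [w + s + c]addrAC; exact: H.
Qed.

Lemma right_derivative_cst w (c : R) : right_derivative (fun=> c) w 0.
Proof.
by move=> e e0; exists 1 => // s /andP[s0 _]; rewrite subrr mul0r subr0 normr0 mulr_ge0// ltW.
Qed.

Lemma right_derivative_ge0 F w l : right_derivative F w l ->
  (forall v, w <= v -> F w <= F v) -> 0 <= l.
Proof.
move=> dF Fw; rewrite leNgt; apply/negP => l0.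
have [d d0 /(_ d)] := dF (- l / 2) ltac:(lra).
rewrite lexx ltW// => /(_ isT); rewrite ler_norml => /andP[_ H].
have : F w <= F (w + d) by rewrite Fw// lerDl ltW.
nra.
Qed.

Lemma right_derivative_lt0 F w l : right_derivative F w l -> l < 0 ->
  exists2 d, 0 < d & forall s, 0 < s <= d -> F (w + s) < F w.
Proof.
move=> dF l0; have [d d0 H] := dF (- l / 2) ltac:(lra).
exists d => // s /andP[s0 sd].
have /H : 0 <= s <= d by rewrite ltW.
rewrite ler_norml => /andP[_]; nra.
Qed.

(** The infimum of the counterexamples would satisfy [P] by the limit clause, and the step clause
    would then push the counterexamples away from it. *)
Lemma real_induction (P : R -> Prop) u : P u ->
  (forall w, u <= w -> (forall v, u <= v <= w -> P v) ->
     exists2 d, 0 < d & forall v, w <= v <= w + d -> P v) ->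
  (forall w, u < w -> (forall v, u <= v < w -> P v) -> P w) ->
  forall w, u <= w -> P w.
Proof.
move=> Pu Pstep Plim w uw; apply: contrapT => nPw.
pose S := [set v | u <= v /\ ~ P v].
have Sinf : has_inf S by split; [exists w | exists u => v [] ].
have us : u <= inf S by apply: lb_le_inf; [exists w | move=> v []].
have Plt v : u <= v < inf S -> P v.
  move=> /andP[uv vs]; apply: contrapT => nPv.
  have : inf S <= v by apply: ge_inf; [exact: Sinf.2|].
  by rewrite leNgt vs.
have Ps : P (inf S).
  move: us; rewrite le_eqVlt => /predU1P[<-//|us]; exact: Plim.
have [|d d0 Pd] := Pstep _ us.
  move=> v /andP[uv]; rewrite le_eqVlt => /predU1P[->//|vs].
  by apply: Plt; rewrite uv.
have [v [uv nPv] vd] := inf_adherent d0 Sinf.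
apply: (nPv); apply: Pd; apply/andP; split; last exact: ltW.
by apply: ge_inf; [exact: Sinf.2|split].
Qed.

Lemma le_limit_left F w u (c M : R) : lipschitz_ge u M F -> u < w ->
  (forall v, u <= v < w -> F v <= c) -> F w <= c.
Proof.
move=> lF uw Fc; apply/ler_addgt0Pr => e e0.
pose M' := `|M| + 1; have M'0 : 0 < M' by rewrite /M'; have := normr_ge0 M; lra.
pose v := Num.max u (w - e / M').
have vw : v < w by rewrite gt_max uw ltrBlDr ltrDl divr_gt0.
have uv : u <= v by rewrite le_max lexx.
have := lF v w; rewrite uv ltW// => /(_ isT); rewrite ler_norml => /andP[_ H].
have := Fc v; rewrite uv vw => /(_ isT) H1.
have H2 : w - v <= e / M' by rewrite lerBlDr -lerBlDl le_max lexx orbT.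
have : M * (w - v) <= e; last lra.
apply: le_trans (_ : M' * (e / M') <= _); last by rewrite mulrC divfK ?gt_eqF.
apply: le_trans (_ : M' * (w - v) <= _); last by rewrite ler_wpM2l// ltW.
rewrite ler_wpM2r ?subr_ge0 ?ltW// /M'.
by have := ler_norm M; lra.
Qed.

(** Continuous induction on [F w <= F u + e * (w - u)]: the small slope [e] pays for the error in
    the right derivative, and the Lipschitz bound passes to limits from the left. *)
Lemma right_derivative_nonincreasing F (l : R -> R) u v (M : R) : u <= v ->
  lipschitz_ge u M F ->
  (forall w, u <= w < v -> right_derivative F w (l w) /\ l w <= 0) ->
  F v <= F u.
Proof.
move=> uv lF dF; apply/ler_addgt0Pr => e0 e00.
pose e := e0 / (v - u + 1).
have e0' : 0 < e by rewrite divr_gt0//; lra.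
suff H w : u <= w -> w <= v -> F w <= F u + e * (w - u).
  apply: le_trans (H v uv (lexx _)) _; rewrite lerD2l /e mulrAC ler_pdivrMr; last lra.
  by rewrite ler_wpM2l ?ltW//; lra.
move=> uw; move: w uw.
apply: (@real_induction (fun w => w <= v -> F w <= F u + e * (w - u))).
- by move=> _; lra.
- move=> w uw Pw; have [wv|vw] := ltP w v; last first.
    exists 1 => // s /andP[ws _] sv.
    have -> : s = w by apply/le_anti; rewrite ws andbT (le_trans sv).
    by apply: Pw; [rewrite uw lexx|exact: le_trans sv].
  have [|d lw0] := dF w; first by rewrite uw.
  have [d' d'0 H] := d e e0'.
  exists d' => // s /andP[ws sd] sv.
  have := H (s - w); rewrite subr_ge0 ws lerBlDl sd => /(_ isT).
  rewrite ler_norml [w + _]addrC subrK => /andP[_ H'].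
  have := Pw w; rewrite uw lexx => /(_ isT (ltW wv)) H2.
  have : l w * (s - w) <= 0 by rewrite mulr_le0_ge0// subr_ge0.
  lra.
- move=> w uw Pw wv; apply: (le_limit_left lF uw) => s /andP[us sw].
  apply: le_trans (Pw s _ _) _; rewrite ?us//; first lra.
  by rewrite lerD2l ler_pM2l//; lra.
Qed.

Lemma gronwall_le0 F (l : R -> R) u (M K : R) : 0 < K ->
  lipschitz_ge u M F -> F u <= 0 ->
  (forall w, u <= w -> right_derivative F w (l w) /\ l w <= K * F w) ->
  forall w, u <= w -> F w <= 0.
Proof.
move=> K0 lF Fu dF w uw; apply/ler_addgt0Pr => e0 e00; rewrite add0r.
(* The barrier [e * E] grows at rate [2 * K]: one [K] covers the growth of [F], the other the error
   allowed in the right derivative. *)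
pose E w := expR (2 * K * (w - u)).
have E0 s : 0 < E s by exact: expR_gt0.
have EM s t : s <= t -> E s <= E t.
  by move=> st; rewrite ler_expR ler_wpM2l ?mulr_ge0 ?(ltW K0)// lerD2r.
pose e := e0 / E w; have ep : 0 < e by rewrite divr_gt0.
suff H t : u <= t -> F t <= e * E t by apply: le_trans (H w uw) _; rewrite divfK ?gt_eqF.
move: t; apply: (@real_induction (fun t => F t <= e * E t)).
- by apply: (le_trans Fu); apply: mulr_ge0; apply: ltW; [exact: ep|exact: E0].
- move=> t ut Pt; have [dFt ltK] := dF t ut.
  have ept : 0 < K * (e * E t) by apply: mulr_gt0 => //; apply: mulr_gt0 => //; exact: E0.
  have [d d0 H] := dFt _ ept; exists d => // s /andP[ts sd].
  have := H (s - t); rewrite subr_ge0 ts lerBlDl sd => /(_ isT).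
  rewrite ler_norml [t + _]addrC subrK => /andP[_ H'].
  have := Pt t; rewrite ut lexx => /(_ isT) H2.
  have H3 : l t <= K * (e * E t) by apply: le_trans ltK _; rewrite ler_pM2l.
  have H4 : l t * (s - t) <= K * (e * E t) * (s - t) by rewrite ler_wpM2r ?subr_ge0.
  have H5 : E t * (1 + 2 * K * (s - t)) <= E s.
    have -> : E s = E t * expR (2 * K * (s - t)).
      by rewrite /E -expRD; congr expR; ring.
    by rewrite ler_pM2l// expR_ge1Dx.
  have : e * (E t * (1 + 2 * K * (s - t))) <= e * E s by rewrite ler_pM2l.
  lra.
- move=> t ut Pt; apply: (le_limit_left lF ut) => s /andP[us st].
  apply: le_trans (Pt s _) _; rewrite ?us//.
  by rewrite ler_pM2l// EM// ltW.
Qed.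

(** The least admissible shift works. If it exceeded [d0] without contact, the gap would have a
    positive minimum on the compact interval, and the shift could be reduced further. *)
Lemma exists_contact_itv (y xb : R -> R) (L L' B d0 M : R) :
  0 <= B -> 0 <= d0 <= M -> lipschitz_ge 0 L y -> lipschitz_ge 0 L' xb ->
  (forall w, 0 <= w <= B -> y (w + M) <= xb w) ->
  exists d, [/\ d0 <= d, (forall w, 0 <= w <= B -> y (w + d) <= xb w) &
    d = d0 \/ exists2 w, 0 <= w <= B & y (w + d) = xb w].
Proof.
move=> B0 /andP[d00 d0M] ly lxb HM.
pose S := [set d | d0 <= d /\ forall w, 0 <= w <= B -> y (w + d) <= xb w].
have SM : S M by [].
have Sinf : has_inf S by split; [exists M | exists d0 => v [] ].
pose d := inf S.
have d0d : d0 <= d by apply: lb_le_inf; [exists M | move=> v []].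
pose L1 := `|L| + 1; have L10 : 0 < L1 by rewrite /L1; have := normr_ge0 L; lra.
have LL1 : L <= L1 by rewrite /L1; have := ler_norm L; lra.
have Sd : S d.
  split => // w /andP[w0 wB]; apply/ler_addgt0Pr => e e0.
  have [t [d0t Ht] td] := inf_adherent (divr_gt0 e0 L10) Sinf.
  have dt : d <= t by apply: ge_inf; [exact: Sinf.2|split].
  have := Ht w; rewrite w0 wB => /(_ isT) H.
  have /ly : 0 <= w + d <= w + t by apply/andP; split; lra.
  rewrite ler_norml => /andP[H1 _].
  have : L * (w + t - (w + d)) <= L1 * (e / L1).
    apply: le_trans (_ : L1 * (w + t - (w + d)) <= _).
      by rewrite ler_wpM2r//; lra.
    by rewrite ler_pM2l//; move: td; rewrite -/d; lra.
  by rewrite [L1 * _]mulrC divfK ?gt_eqF//; lra.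
exists d; split => //; first exact: Sd.2.
move: (d0d); rewrite le_eqVlt => /predU1P[->|d0ltd]; first by left.
right; apply: contrapT => nc.
(* Composing with [Num.max 0] extends the gap continuously to negative levels, where nothing is
   known about [y] and [xb]. *)
pose phi w := xb (Num.max 0 w) - y (Num.max 0 w + d).
have max_lip (v w : R) : v <= w -> 0 <= Num.max 0 w - Num.max 0 v <= w - v.
  by move=> vw; rewrite /Num.max; case: ifPn; case: ifPn; rewrite -?leNgt; lra.
have cphi : continuous phi.
  apply: (@lipschitz_continuous _ phi (L1 + `|L'|)).
    by have := normr_ge0 L'; lra.
  move=> v w vw; have /andP[m1 m2] := max_lip _ _ vw.
  have m0 : 0 <= Num.max 0 v by rewrite le_max lexx.
  have h1 : `|xb (Num.max 0 w) - xb (Num.max 0 v)| <= `|L'| * (w - v).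
    apply: le_trans (_ : L' * (Num.max 0 w - Num.max 0 v) <= _).
      by apply: lxb; rewrite m0 -subr_ge0.
    apply: le_trans (_ : `|L'| * (Num.max 0 w - Num.max 0 v) <= _).
      by rewrite ler_wpM2r// ler_norm.
    by rewrite ler_wpM2l.
  have h2 : `|y (Num.max 0 w + d) - y (Num.max 0 v + d)| <= L1 * (w - v).
    apply: le_trans (_ : L * (Num.max 0 w + d - (Num.max 0 v + d)) <= _).
      by apply: ly; rewrite addr_ge0//=; lra.
    apply: le_trans (_ : L1 * (Num.max 0 w - Num.max 0 v) <= _).
      by rewrite (_ : _ + d - _ = Num.max 0 w - Num.max 0 v) ?ler_wpM2r//; ring.
    by rewrite ler_wpM2l// ltW.
  rewrite /phi.
  rewrite (_ : _ - _ = (xb (Num.max 0 w) - xb (Num.max 0 v)) -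
    (y (Num.max 0 w + d) - y (Num.max 0 v + d))); last ring.
  by apply: le_trans (ler_normB _ _) _; lra.
have [c cB cmin] := EVT_min B0 (continuous_subspaceT cphi).
have c0B : 0 <= c <= B by move: cB; rewrite in_itv.
have maxE w : 0 <= w -> Num.max 0 w = w by move=> ?; exact/max_r.
have phic : 0 < phi c.
  rewrite lt_neqAle /phi maxE; last by case/andP: c0B.
  rewrite subr_ge0 Sd.2// andbT eq_sym subr_eq0; apply/negP => /eqP E.
  by apply: nc; exists c.
(* Reducing the shift by [phi c / L1] raises [y] by at most the minimal gap [phi c]. *)
pose d' := Num.max d0 (d - phi c / L1).
have d'd : d' < d by rewrite gt_max d0ltd ltrBlDr ltrDl divr_gt0.
suff Sd' : S d'.
  have : d <= d' by apply: ge_inf; [exact: Sinf.2|].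
  by rewrite leNgt d'd.
have d0d' : d0 <= d' by rewrite le_max lexx.
split => // w wB; have /andP[w0 _] := wB.
have := cmin w; rewrite in_itv/= => /(_ wB); rewrite {2}/phi maxE// => H.
have /ly : 0 <= w + d' <= w + d by apply/andP; split; lra.
rewrite ler_norml => /andP[H1 _].
have : L * (w + d - (w + d')) <= L1 * (phi c / L1).
  apply: le_trans (_ : L1 * (w + d - (w + d')) <= _).
    by rewrite ler_wpM2r//; lra.
  rewrite ler_pM2l//.
  have : d - phi c / L1 <= d' by rewrite le_max lexx orbT.
  lra.
by rewrite [L1 * _]mulrC divfK ?gt_eqF//; lra.
Qed.

(** The constant [c] separates the functions beyond [B], whatever the shift, so only [[0, B]]
    matters; a shift by at least [B] separates them everywhere. *)
Lemma exists_contact (y xb : R -> R) (L L' B d0 c : R) :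
  0 <= B -> 0 <= d0 -> lipschitz_ge 0 L y -> lipschitz_ge 0 L' xb ->
  (forall w, B <= w -> y w <= c) -> (forall w, 0 <= w -> c <= xb w) ->
  exists d, [/\ d0 <= d, (forall w, 0 <= w -> y (w + d) <= xb w) &
    d = d0 \/ exists2 w, 0 <= w & y (w + d) = xb w].
Proof.
move=> B0 d00 ly lxb yc xbc.
have [||d [d0d H C]] := @exists_contact_itv y xb L L' B d0 (Num.max d0 B) B0 _ ly lxb.
- by rewrite d00 le_max lexx.
- move=> w /andP[w0 wB]; apply: le_trans (xbc _ w0); apply: yc.
  apply: le_trans (_ : Num.max d0 B <= _); last by rewrite lerDr.
  by rewrite le_max lexx orbT.
exists d; split => // [w w0|].
  have [wB|Bw] := leP w B; first by apply: H; rewrite w0.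
  apply: le_trans (xbc _ w0); apply: yc.
  by rewrite (le_trans (ltW Bw))// lerDl (le_trans d00).
by case: C => [->|[w /andP[w0 _] E]]; [left|right; exists w].
Qed.

End RightDerivative.

(** * Expected crossings of a class *)

Section CrossingCount.
Context (R : realType).

Lemma lt_nth_sorted (s : seq (\bar R)) (w : \bar R) k : sorted <=%O s ->
  (w < +oo)%E ->
  (w < nth +oo%E s k)%E = (count (fun z => (z <= w)%E) s <= k)%N.
Proof.
move=> + woo; elim: s k => [|z s IH] k /=; first by rewrite nth_nil woo.
move=> zs; have ss := path_sorted zs.
have [zw|wz] := leP z w.
  by case: k => [|k] /=; [rewrite ltNge zw|rewrite IH].
have wall u : u \in s -> (w < u)%E.
  move=> us; apply: lt_le_trans wz _.
  by move: zs; rewrite (path_sortedE (@le_trans _ _)) => /andP[/allP /(_ _ us)].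
have -> : count (fun z0 => (z0 <= w)%E) s = 0%N.
  apply/eqP; rewrite -leqn0 leqNgt -has_count.
  by apply/hasPn => u /wall; rewrite -ltNge.
rewrite leq0n; case: k => [//|k] /=.
have [ks|sk] := ltnP k (size s); last by rewrite nth_default.
by rewrite wall// mem_nth.
Qed.

Lemma lt_kth_smallest (s : seq (\bar R)) (w : R) k : (0 < k)%N ->
  (w%:E < kth_smallest k s)%E = (count (fun z => (z <= w%:E)%E) s < k)%N.
Proof.
move=> k0; rewrite /kth_smallest lt_nth_sorted ?ltry//; last first.
  by apply: sort_sorted; exact: le_total.
rewrite (seq.permP (permEl (perm_sort _ _))).
by case: k k0.
Qed.

Lemma few_indicator (I : Type) (h : I -> bool) (r : seq I) k :
  few (fun i => (h i)%:R : R) r k = (count (predC h) r < k)%N%:R.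
Proof.
elim: r k => [|i r IH] k //=; rewrite !IH.
case: (h i) => /=; first by rewrite subrr mul0r add0r mul1r add0n.
by rewrite subr0 mul1r mul0r addr0 add1n; case: k.
Qed.

(** For deterministic events cancellation is all or nothing. Since [m i] implies [h i], a server
    able to cross is not among the early completions, so counting the others amounts to counting
    all. *)
Lemma cross_indicator (I : Type) (m h : I -> bool) (r : seq I) k :
  (forall i, m i -> h i) ->
  cross (fun i => (m i)%:R : R) (fun i => (h i)%:R) r k =
    ((\sum_(i <- r) m i) * (count (predC h) r < k))%N%:R.
Proof.
move=> mh; elim: r k => [|i r IH] k /=; first by rewrite big_nil mul0n.
rewrite big_cons !IH few_indicator; move: (mh i).
case: (h i) => /= [_|]; first by rewrite add0n mulnDl natrD !natrM; ring.
case: (m i) => [/(_ isT)//|_] /=.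
rewrite add0n add1n subr0 mul1r !mul0r !addr0.
by case: k => [|k] //=; rewrite ltn0 muln0.
Qed.

(** The completion level exceeds [w] exactly when fewer than [k] servers would finish by [w]; then
    each server with [W_i <= w < W_i + xi_i] crosses, and otherwise none does. *)
Lemma crossingsE k n (W : n.-tuple (\bar R)) (xi : n.-tuple R) (w : R) :
  (0 < k)%N ->
  (crossings k W xi w)%:R =
  cross (fun i => ((tnth W i <= w%:E)%E &&
                   (w%:E < tnth W i + (tnth xi i)%:E)%E)%:R : R)
    (fun i => (w%:E < tnth W i + (tnth xi i)%:E)%E%:R) (enum 'I_n) k.
Proof.
move=> k0; rewrite cross_indicator => [|i /andP[]//].
congr (_%:R); rewrite /crossings big_distrl/= big_enum/=.
apply: eq_bigr => i _; rewrite /new_workload lt_max lt_min.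
rewrite lt_kth_smallest// count_map.
have -> : count (preim (fun i => (tnth W i + (tnth xi i)%:E)%E)
    (fun z => (z <= w%:E)%E)) (enum 'I_n) =
  count (predC (fun i => (w%:E < tnth W i + (tnth xi i)%:E)%E)) (enum 'I_n).
  by apply: eq_count => l /=; rewrite -leNgt.
have [Wiw|wWi] := leP (tnth W i) w%:E; last by [].
by rewrite /= mulnb.
Qed.

End CrossingCount.

(** * Averaging the crossing polynomial over i.i.d. workloads *)

Section IidExpectation.
Context d (T : measurableType d) (R : realType).

Lemma measurable_few d' (S : measurableType d') (I : Type) (a : I -> S -> R) r k :
  (forall i, measurable_fun setT (a i)) ->
  measurable_fun setT (fun z => few (a^~ z) r k).
Proof.
move=> ma; elim: r k => [|i r IH] k /=; first exact: measurable_cst.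
apply: measurable_funD; apply: measurable_funM => //.
by apply: measurable_funB => //; exact: measurable_cst.
Qed.

Lemma measurable_cross d' (S : measurableType d') (I : Type)
    (e a : I -> S -> R) r k :
  (forall i, measurable_fun setT (e i)) ->
  (forall i, measurable_fun setT (a i)) ->
  measurable_fun setT (fun z => cross (e^~ z) (a^~ z) r k).
Proof.
move=> me ma; elim: r k => [|i r IH] k /=; first exact: measurable_cst.
apply: measurable_funD; last first.
  by apply: measurable_funM => //; exact: measurable_few.
apply: measurable_funD; apply: measurable_funM => //.
by apply: measurable_funB => //; exact: measurable_cst.
Qed.

Lemma few_map (I I' : Type) (f : I -> I') (a : I' -> R) r k :
  few a (map f r) k = few (a \o f) r k.
Proof. by elim: r k => //= i r IH k; rewrite !IH. Qed.

Lemma cross_map (I I' : Type) (f : I -> I') (e a : I' -> R) r k :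
  cross e a (map f r) k = cross (e \o f) (a \o f) r k.
Proof. by elim: r k => //= i r IH k; rewrite !IH few_map. Qed.

Lemma integral_iid_cons (mu : probability T R) n (f : n.+1.-tuple T -> R) :
  measurable_fun setT f -> (forall v, 0 <= f v) ->
  (\int[iid_law mu n.+1]_v (f v)%:E =
   \int[mu]_x \int[iid_law mu n]_v (f (tuple_cons (x, v)))%:E)%E.
Proof.
move=> mf f0.
have mf' : measurable_fun setT (fun v => (f v)%:E) by exact/measurable_EFinP.
rewrite /= ge0_integral_distribution; [|exact: mf'|by move=> v; rewrite lee_fin].
apply: (fubini_tonelli1 (fun z => (f (tuple_cons z))%:E)).
- by apply: measurableT_comp mf' _; exact: measurable_tuple_cons.
- by move=> z; rewrite lee_fin.
Qed.

Lemma ge0_integral_lincomb d' (S : measurableType d') (P : probability S R)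
    (f g h : S -> R) (p q r F G H : R) :
  measurable_fun setT f -> measurable_fun setT g -> measurable_fun setT h ->
  (forall z, 0 <= f z) -> (forall z, 0 <= g z) -> (forall z, 0 <= h z) ->
  0 <= p -> 0 <= q -> 0 <= r ->
  (\int[P]_z (f z)%:E = F%:E)%E -> (\int[P]_z (g z)%:E = G%:E)%E ->
  (\int[P]_z (h z)%:E = H%:E)%E ->
  (\int[P]_z (p * f z + q * g z + r * h z)%:E = (p * F + q * G + r * H)%:E)%E.
Proof.
move=> mf mg mh f0 g0 h0 p0 q0 r0 If Ig Ih.
have mZ (c : R) (u : S -> R) : measurable_fun setT u ->
    measurable_fun setT (fun z => (c * u z)%:E).
  by move=> mu'; apply/measurable_EFinP; apply: measurable_funM.
have IZ (c : R) (u : S -> R) U : measurable_fun setT u -> (forall z, 0 <= u z) ->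
    0 <= c -> (\int[P]_z (u z)%:E = U%:E)%E -> (\int[P]_z (c * u z)%:E = (c * U)%:E)%E.
  move=> mu' u0 c0 Iu; rewrite EFinM -Iu -ge0_integralZl//.
  - exact/measurable_EFinP.
  - by move=> z _; rewrite lee_fin.
under eq_integral do rewrite !EFinD.
rewrite !ge0_integralD//=; first by rewrite !EFinD (IZ _ _ F)// (IZ _ _ G)// (IZ _ _ H).
all: try by move=> z _; rewrite lee_fin mulr_ge0.
all: try by move=> z _; apply: adde_ge0; rewrite lee_fin mulr_ge0.
all: try exact: mZ.
by apply: emeasurable_funD; exact: mZ.
Qed.

Lemma integral_onem (P : probability T R) (a : T -> R) (A : R) :
  measurable_fun setT a -> (forall z, 0 <= a z <= 1) ->
  (\int[P]_z (a z)%:E = A%:E)%E -> (\int[P]_z (1 - a z)%:E = (1 - A)%:E)%E.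
Proof.
move=> ma a01 Ia.
have ia : P.-integrable setT (EFin \o a).
  apply: measurable_bounded_integrable => //; first exact: (le_lt_trans (probability_le1 P measurableT) (ltry _)).
  exists 1; split => // x x1 z _; have /andP[a0 a1] := a01 z.
  by rewrite /= ger0_norm// (le_trans a1)// ltW.
have i1 : P.-integrable setT (EFin \o cst (1:R)).
  apply: measurable_bounded_integrable => //; first exact: (le_lt_trans (probability_le1 P measurableT) (ltry _)).
  by exists 1; split => // x x1 z _; rewrite /= normr1 ltW.
have -> : (\int[P]_z (1 - a z)%:E = \int[P]_z (cst (1:R) z - a z)%:E)%E by [].
transitivity (1 * P setT - A%:E)%E; last by rewrite probability_setT mul1e EFinB.
by rewrite integralB_EFin//= Ia integral_cst.
Qed.

Section Means.
Context (mu : probability T R).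

(** [few] is affine in each of its arguments and these depend on independent coordinates, so the
    mean passes inside. The induction integrates the first coordinate last. *)
Lemma integral_iid_few n (a : 'I_n -> T -> R) (A : 'I_n -> R) k :
  (forall i, measurable_fun setT (a i)) -> (forall i z, 0 <= a i z <= 1) ->
  (forall i, \int[mu]_z (a i z)%:E = (A i)%:E)%E ->
  (\int[iid_law mu n]_v (few (fun i => a i (tnth v i)) (enum 'I_n) k)%:E =
   (few A (enum 'I_n) k)%:E)%E.
Proof.
elim: n a A k => [|n IHn] a A k ma a01 Ia.
  rewrite !enum_ord0.
  transitivity ((few A [::] k)%:E * iid_law mu 0 [set: 0.-tuple T])%E.
    by rewrite -integral_cst//; exact: eq_integral.
  by rewrite probability_setT mule1.
have mt m (b : 'I_m -> T -> R) : (forall i, measurable_fun setT (b i)) -> forall i,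
    measurable_fun setT (fun v : m.-tuple T => b i (tnth v i)).
  by move=> mb i; apply: measurableT_comp => //; exact: measurable_tnth.
rewrite integral_iid_cons; last 2 first.
- by apply: measurable_few; exact: mt.
- by move=> v; have /andP[] := few_itv (fun i => a01 i (tnth v i)) (enum 'I_n.+1) k.
rewrite enum_ordSl.
pose a' i := a (lift ord0 i); pose A' i := A (lift ord0 i).
have IH l : (\int[iid_law mu n]_v (few (fun i => a' i (tnth v i)) (enum 'I_n) l)%:E =
   (few A' (enum 'I_n) l)%:E)%E by apply: IHn => i; [exact: ma|exact: a01|exact: Ia].
have ge0 v l : 0 <= few (fun i => a' i (tnth v i)) (enum 'I_n) l.
  by have /andP[] := few_itv (fun i => a01 (lift ord0 i) (tnth v i)) (enum 'I_n) l.
have A01 l : 0 <= few A' (enum 'I_n) l.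
  by rewrite -lee_fin -IH integral_ge0// => v _; rewrite lee_fin.
transitivity (\int[mu]_x ((few A' (enum 'I_n) k.-1) * (1 - a ord0 x) +
    (few A' (enum 'I_n) k) * a ord0 x + 0 * 0)%:E)%E; last first.
  rewrite (ge0_integral_lincomb (h := fun=> 0) (F := 1 - A ord0) (G := A ord0) (H := 0))//=.
  - by rewrite !(few_map (lift ord0)); congr EFin; rewrite /A' /comp; ring.
  - by apply: measurable_funB => //; exact: measurable_cst.
  - by move=> z; have /andP[] := a01 ord0 z; lra.
  - by move=> z; have /andP[] := a01 ord0 z.
  - exact: integral_onem.
  - by rewrite integral0.
apply: eq_integral => x _.
transitivity (\int[iid_law mu n]_v
   ((1 - a ord0 x) * few (fun i => a' i (tnth v i)) (enum 'I_n) k.-1 +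
    a ord0 x * few (fun i => a' i (tnth v i)) (enum 'I_n) k + 0 * 0)%:E)%E.
  apply: eq_integral => v _ /=; rewrite !(few_map (lift ord0)) tnth0 mulr0 addr0; congr EFin.
  have E l : few ((fun i => a i (tnth (tuple_cons (x, v)) i)) \o lift ord0) (enum 'I_n) l
     = few (fun i => a' i (tnth v i)) (enum 'I_n) l.
    by congr few; apply/funext => i; rewrite /= tnthS.
  by rewrite !E.
have /andP[? ?] := a01 ord0 x.
rewrite (ge0_integral_lincomb (h := fun=> 0) (F := few A' (enum 'I_n) k.-1)
  (G := few A' (enum 'I_n) k) (H := 0))//=.
- by congr EFin; ring.
- by apply: measurable_few; apply: mt => i; exact: ma.
- by apply: measurable_few; apply: mt => i; exact: ma.
- by rewrite subr_ge0.
- by rewrite integral0.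
Qed.

(** [e i] and [a i] depend on the same coordinate, but no product [e i * a i] occurs in [cross]:
    [e i] is multiplied only by terms of the other servers. So here too only the separate means
    matter. *)
Lemma integral_iid_cross n (e a : 'I_n -> T -> R) (E A : 'I_n -> R) k :
  (forall i, measurable_fun setT (e i)) -> (forall i z, 0 <= e i z) ->
  (forall i, measurable_fun setT (a i)) -> (forall i z, 0 <= a i z <= 1) ->
  (forall i, \int[mu]_z (e i z)%:E = (E i)%:E)%E ->
  (forall i, \int[mu]_z (a i z)%:E = (A i)%:E)%E ->
  (\int[iid_law mu n]_v (cross (fun i => e i (tnth v i))
     (fun i => a i (tnth v i)) (enum 'I_n) k)%:E =
   (cross E A (enum 'I_n) k)%:E)%E.
Proof.
elim: n e a E A k => [|n IHn] e a E A k me e0 ma a01 Ie Ia.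
  by rewrite !enum_ord0 /= integral0.
have mt m (b : 'I_m -> T -> R) : (forall i, measurable_fun setT (b i)) -> forall i,
    measurable_fun setT (fun v : m.-tuple T => b i (tnth v i)).
  by move=> mb i; apply: measurableT_comp => //; exact: measurable_tnth.
have cross0 m (b c : 'I_m -> R) r l : (forall i, 0 <= b i) ->
    (forall i, 0 <= c i <= 1) -> 0 <= cross b c r l.
  by move=> b0 c01; have [/andP[+ _] _] := cross_bounds c01 b0 r l.+1.
rewrite integral_iid_cons; last 2 first.
- by apply: measurable_cross; exact: mt.
- by move=> v; apply: cross0.
rewrite enum_ordSl.
pose a' i := a (lift ord0 i); pose A' i := A (lift ord0 i).
pose e' i := e (lift ord0 i); pose E' i := E (lift ord0 i).
pose X v l := cross (fun i => e' i (tnth v i)) (fun i => a' i (tnth v i)) (enum 'I_n) l.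
pose Y v l := few (fun i => a' i (tnth v i)) (enum 'I_n) l.
have IH l : (\int[iid_law mu n]_v (X v l)%:E = (cross E' A' (enum 'I_n) l)%:E)%E.
  by apply: IHn => i; [exact: me|exact: e0|exact: ma|exact: a01|exact: Ie|exact: Ia].
have IF l : (\int[iid_law mu n]_v (Y v l)%:E = (few A' (enum 'I_n) l)%:E)%E.
  by apply: integral_iid_few => i; [exact: ma|exact: a01|exact: Ia].
have X0 v l : 0 <= X v l by apply: cross0 => i; [exact: e0|exact: a01].
have Y0 v l : 0 <= Y v l.
  by have /andP[] := few_itv (fun i => a01 (lift ord0 i) (tnth v i)) (enum 'I_n) l.
have A0 l : 0 <= few A' (enum 'I_n) l.
  by rewrite -lee_fin -IF integral_ge0// => v _; rewrite lee_fin.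
have E0 l : 0 <= cross E' A' (enum 'I_n) l.
  by rewrite -lee_fin -IH integral_ge0// => v _; rewrite lee_fin.
transitivity (\int[mu]_x ((cross E' A' (enum 'I_n) k.-1) * (1 - a ord0 x) +
    (cross E' A' (enum 'I_n) k) * a ord0 x + few A' (enum 'I_n) k * e ord0 x)%:E)%E;
    last first.
  rewrite (ge0_integral_lincomb (F := 1 - A ord0) (G := A ord0) (H := E ord0))//=.
  - by rewrite !(cross_map (lift ord0)) !(few_map (lift ord0)); congr EFin; rewrite /A' /E' /comp; ring.
  - by apply: measurable_funB => //; exact: measurable_cst.
  - by move=> z; have /andP[] := a01 ord0 z; lra.
  - by move=> z; have /andP[] := a01 ord0 z.
  - exact: integral_onem.
apply: eq_integral => x _.
transitivity (\int[iid_law mu n]_v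
   ((1 - a ord0 x) * X v k.-1 + a ord0 x * X v k + e ord0 x * Y v k)%:E)%E.
  apply: eq_integral => v _ /=; rewrite !(cross_map (lift ord0)) !(few_map (lift ord0)) tnth0; congr EFin.
  have EX l : cross ((fun i => e i (tnth (tuple_cons (x, v)) i)) \o lift ord0)
     ((fun i => a i (tnth (tuple_cons (x, v)) i)) \o lift ord0) (enum 'I_n) l = X v l.
    by congr cross; apply/funext => i; rewrite /= tnthS.
  have EY l : few ((fun i => a i (tnth (tuple_cons (x, v)) i)) \o lift ord0) (enum 'I_n) l
     = Y v l by congr few; apply/funext => i; rewrite /= tnthS.
  by rewrite !EX EY.
have /andP[? ?] := a01 ord0 x.
rewrite (ge0_integral_lincomb (F := cross E' A' (enum 'I_n) k.-1)
  (G := cross E' A' (enum 'I_n) k) (H := few A' (enum 'I_n) k))//=.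
- by congr EFin; ring.
- by apply: measurable_cross; apply: mt => i; [exact: me|exact: ma].
- by apply: measurable_cross; apply: mt => i; [exact: me|exact: ma].
- by apply: measurable_few; apply: mt => i; exact: ma.
- by rewrite subr_ge0.
Qed.

End Means.
End IidExpectation.

Section MeasureFacts.
Context d (T : measurableType d) (R : realType).

Lemma measurable_natr_bool (b : T -> bool) :
  measurable_fun setT b -> measurable_fun setT (fun z => (b z)%:R : R).
Proof.
move=> mb; rewrite (_ : (fun z => _) = \1_[set z | b z]).
  apply: measurable_indic; rewrite -[X in measurable X]setTI.
  by rewrite (_ : [set z | b z] = b @^-1` [set true])//; exact: mb.
apply/funext => z; rewrite indicE.
by have -> : (z \in [set z | b z]) = b z by apply/idP/idP; rewrite inE.
Qed.

Lemma integral_natr_bool (P : probability T R) (b : T -> bool) :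
  measurable_fun setT b ->
  (\int[P]_z ((b z)%:R : R)%:E = P [set z | b z])%E.
Proof.
move=> mb; have mS : measurable [set z | b z].
  rewrite -[X in measurable X]setTI.
  by rewrite (_ : [set z | b z] = b @^-1` [set true])//; exact: mb.
rewrite -[X in P X]setIT -integral_indic//; apply: eq_integral => z _.
rewrite indicE.
by have -> : (z \in [set z | b z]) = b z by apply/idP/idP; rewrite inE.
Qed.

Lemma ae_probability1 (P : probability T R) (A : set T) : measurable A ->
  P A = 1%E -> {ae P, forall z, A z}.
Proof.
move=> mA PA; exists (~` A); split => //; first exact: measurableC.
by rewrite probability_setC// PA subee.
Qed.

Lemma probability_bounded_integrable (P : probability T R) (f : T -> R) (M : R) :
  measurable_fun setT f -> (forall z, `|f z| <= M) ->
  P.-integrable setT (EFin \o f).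
Proof.
move=> mf fM; apply: measurable_bounded_integrable => //.
  exact: (le_lt_trans (probability_le1 P measurableT) (ltry _)).
exists M; split; first exact: num_real.
by move=> x Mx z _; rewrite /= (le_trans (fM z))// ltW.
Qed.

Lemma nonincreasing_measurable (f : R -> R) : {homo f : u v / u <= v >-> v <= u} ->
  measurable_fun setT f.
Proof.
move=> hf; apply: (measurability _ (RGenOInfty.measurableE R)) => _ [_ [r ->] <-].
rewrite setTI; apply: is_interval_measurable => a b /= qa qb c /andP[ac cb].
move: qb; rewrite /= !in_itv/= !andbT => /lt_le_trans; apply; exact: hf.
Qed.

End MeasureFacts.

(** * Mean crossings of a class with given tails *)

Section ClassMeans.
Context (R : realType).
Implicit Types (x : R -> R) (w v : R).

Lemma measurable_orthant n :
  measurable [set t : n.-tuple R | forall i, 0 <= tnth t i].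
Proof.
rewrite (_ : [set _ | _] =
    \bigcap_(i in [set: 'I_n]) ((fun t => tnth t i) @^-1` `[0, +oo[)).
  apply: fin_bigcap_measurable => // i _; rewrite -[X in measurable X]setTI.
  by apply: measurable_tnth.
apply/seteqP; split => t /= H i; first by move=> _; rewrite /= in_itv/= andbT.
by have := H i I; rewrite /= in_itv/= andbT.
Qed.

(* Workloads are nonnegative, so their tail is [1] on the negative reals. *)
Definition tail_ext x v := if v < 0 then 1 else x v.

Lemma tail_ext_ge0 x v : 0 <= v -> tail_ext x v = x v.
Proof. by rewrite /tail_ext ltNge => ->. Qed.

Lemma tail_ext_itv x v : in_X x -> 0 <= tail_ext x v <= 1.
Proof.
move=> [_ _ x01]; rewrite /tail_ext; case: ltP => [_|/x01//].
by rewrite ler01 lexx.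
Qed.

Lemma tail_ext_nonincreasing x : in_X x ->
  {homo tail_ext x : u v / u <= v >-> v <= u}.
Proof.
move=> xX u v uv; have [xd _ x01] := xX; have /andP[_ xv1] := tail_ext_itv v xX.
have [u0|u0] := ltP u 0; first by rewrite {2}/tail_ext u0.
rewrite !tail_ext_ge0 ?(le_trans u0)//; apply: xd; rewrite // in_itv/= andbT//.
exact: le_trans uv.
Qed.

Lemma workload_law_gt x v : in_X x ->
  workload_law x [set W | (v%:E < W)%E] = (tail_ext x v)%:E.
Proof.
move=> xX; rewrite /tail_ext; case: ltP => v0; last exact: workload_law_tail.
have mset u : measurable [set W : \bar R | (u%:E < W)%E].
  by rewrite -set_itvoy; exact: emeasurable_itv.
have mge : measurable [set W : \bar R | (0 <= W)%E].
  by rewrite -set_itvcy; exact: emeasurable_itv.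
apply/eqP; rewrite eq_le probability_le1//=.
rewrite -(workload_law_ge0 x) le_measure ?inE//.
by move=> W /=; apply: lt_le_trans; rewrite lte_fin.
Qed.

Lemma workload_law_between x v w : in_X x -> 0 <= w -> v <= w ->
  workload_law x [set W | (W <= w%:E)%E && (v%:E < W)%E] =
  (tail_ext x v - x w)%:E.
Proof.
move=> xX w0 vw.
have mset u : measurable [set W : \bar R | (u%:E < W)%E].
  by rewrite -set_itvoy; exact: emeasurable_itv.
have -> : [set W | (W <= w%:E)%E && (v%:E < W)%E] =
    [set W | (v%:E < W)%E] `\` [set W | (w%:E < W)%E].
  apply/seteqP; split => W /=.
    by move=> /andP[Ww vW]; split => //; apply/negP; rewrite -leNgt.
  by move=> [-> /negP]; rewrite -leNgt => ->.
rewrite measureD//; last first.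
  by apply: (le_lt_trans (probability_le1 _ _) (ltry _)).
rewrite setIidr; last by move=> W /=; apply: le_lt_trans; rewrite lee_fin.
rewrite EFinB; congr (_ - _)%E; first exact: workload_law_gt.
exact: workload_law_tail.
Qed.

(** Sizes are nonnegative only almost surely; truncating them at [0] makes the later inequalities
    hold for every [xi]. *)
Definition size_tail x w n (xi : n.-tuple R) (i : 'I_n) : R :=
  tail_ext x (w - Num.max 0 (tnth xi i)).

(** The conditional mean of [crossings] given the sizes, see [integral_crossings]: server [i] can
    cross if its workload lies in [(w - xi_i, w]], and does not finish by [w] if its workload
    exceeds [w - xi_i]. *)
Definition crossing_mean k x w n (xi : n.-tuple R) : R :=
  cross (fun i => size_tail x w xi i - x w) (size_tail x w xi) (enum 'I_n) k.

Lemma size_tail_itv x w n (xi : n.-tuple R) i : in_X x ->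
  0 <= size_tail x w xi i <= 1.
Proof. by move=> xX; exact: tail_ext_itv. Qed.

Lemma size_tail_ge x w n (xi : n.-tuple R) i : in_X x -> 0 <= w ->
  x w <= size_tail x w xi i.
Proof.
move=> xX w0; rewrite -[leLHS](tail_ext_ge0 x w0); apply: tail_ext_nonincreasing => //.
by rewrite gerBl le_max lexx.
Qed.

Lemma measurable_size_tail x w n (i : 'I_n) : in_X x ->
  measurable_fun setT (fun xi => size_tail x w xi i).
Proof.
move=> xX.
apply: (measurableT_comp (f := fun v : R => tail_ext x (w - Num.max 0 v)));
  last exact: measurable_tnth.
rewrite (_ : (fun v => _) = \- (fun v : R => - tail_ext x (w - Num.max 0 v))).
  apply: measurable_funN.
  apply: nonincreasing_measurable => u v uv; rewrite lerN2.
  apply: tail_ext_nonincreasing => //; rewrite lerD2l lerN2.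
  by rewrite ge_max !le_max lexx /= uv orbT.
by apply/funext => v /=; rewrite opprK.
Qed.

Lemma crossing_mean_itv k x w n (xi : n.-tuple R) : in_X x -> 0 <= w ->
  0 <= crossing_mean k x w xi <= n%:R.
Proof.
move=> xX w0; rewrite /crossing_mean.
have a01 i := size_tail_itv w xi i xX.
have e0 i : 0 <= size_tail x w xi i - x w by rewrite subr_ge0; exact: size_tail_ge.
have [/andP[c0 _] _] := cross_bounds a01 e0 (enum 'I_n) k.+1.
have [_ cS] := cross_bounds a01 e0 (enum 'I_n) k.
rewrite c0 /=; apply: le_trans cS _.
apply: le_trans (_ : \sum_(i <- enum 'I_n) 1 <= _).
  apply: ler_sum => i _; have /andP[_ ?] := a01 i.
  have [_ _ /(_ w w0) /andP[? _]] := xX; lra.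
by rewrite big_enum/= sumr_const card_ord.
Qed.

Lemma measurable_crossing_mean k x w n : in_X x ->
  measurable_fun setT (fun xi : n.-tuple R => crossing_mean k x w xi).
Proof.
move=> xX; apply: (@measurable_cross R _ _ 'I_n
  (fun i xi => size_tail x w xi i - x w) (fun i xi => size_tail x w xi i)) => i.
  by apply: measurable_funB; [exact: measurable_size_tail|exact: measurable_cst].
exact: measurable_size_tail.
Qed.

Lemma integral_crossings k x w n (xi : n.-tuple R) : (0 < k)%N -> in_X x ->
  0 <= w -> (forall i, 0 <= tnth xi i) ->
  (\int[iid_law (workload_law x) n]_W ((crossings k W xi w)%:R : R)%:E =
   (crossing_mean k x w xi)%:E)%E.
Proof.
move=> k0 xX w0 xi0.
under eq_integral do rewrite crossingsE//.
have mlt i : measurable_fun setT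
    (fun W : \bar R => (w%:E < W + (tnth xi i)%:E)%E).
  apply: measurable_fun_lte; first exact: measurable_cst.
  by apply: emeasurable_funD; [exact: measurable_id|exact: measurable_cst].
have mle : measurable_fun setT (fun W : \bar R => (W <= w%:E)%E).
  by apply: measurable_fun_lee; [exact: measurable_id|exact: measurable_cst].
have ltE i W : (w%:E < W + (tnth xi i)%:E)%E = ((w - tnth xi i)%:E < W)%E.
  by rewrite EFinB lteBlDr.
have maxE i : Num.max 0 (tnth xi i) = tnth xi i by exact/max_r.
apply: (@integral_iid_cross _ _ R (workload_law x) n
  (fun i W => ((W <= w%:E)%E && (w%:E < W + (tnth xi i)%:E)%E)%:R)
  (fun i W => (w%:E < W + (tnth xi i)%:E)%E%:R)) => //.
- by move=> i; apply: measurable_natr_bool; apply: measurable_and.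
- by move=> i; exact: measurable_natr_bool.
- by move=> i z; case: (_ < _)%E; rewrite ?lexx ?ler01.
- move=> i; rewrite integral_natr_bool; last exact: measurable_and.
  under eq_set do rewrite ltE.
  by rewrite workload_law_between// /size_tail ?maxE// gerBl.
- move=> i; rewrite integral_natr_bool//.
  under eq_set do rewrite ltE.
  by rewrite workload_law_gt// /size_tail maxE.
Qed.

Definition mean_crossings (c : job_class R) x w : R :=
  \int[size_law c]_xi crossing_mean (needed c) x w xi.

Lemma class_crossingsE (J : finType) (cls : J -> job_class R) x w j :
  valid_class (cls j) -> in_X x -> 0 <= w ->
  class_crossings cls x w j = (mean_crossings (cls j) x w)%:E.
Proof.
move=> [kd _ xi0] xX w0; rewrite /class_crossings /mean_crossings.
set k := needed _ in kd *; set P := size_law _ in xi0 *.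
have mP := @measurable_orthant (width (cls j)).
have IE : (\int[P]_xi (crossing_mean k x w xi)%:E =
    (\int[P]_xi crossing_mean k x w xi)%R%:E)%E.
  rewrite /Rintegral fineK//; apply: integrable_fin_num => //.
  apply: (@probability_bounded_integrable _ _ _ _ _ (width (cls j))%:R).
    exact: measurable_crossing_mean.
  move=> z; have /andP[? ?] := crossing_mean_itv k z xX w0.
  by rewrite ger0_norm.
(* The polynomial describes [crossings] only for positive [k]; in the empty class both sides vanish
   for lack of servers. *)
rewrite -IE; have [/andP[k0 _]|[k0 n0]] := kd; last first.
  have n0' (i : 'I_(width (cls j))) : False by move: i; rewrite n0; case.
  rewrite integral0_eq => [|z _]; last first.
    by rewrite /crossings big_pred0// => i; case: (n0' i).
  rewrite integral0_eq// => z _; congr EFin.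
  rewrite /crossing_mean; case: (enum _) => [//|i]; by case: (n0' i).
have mc : measurable_fun setT (fun z : (width (cls j)).-tuple R *
    (width (cls j)).-tuple (\bar R) => ((crossings k z.2 z.1 w)%:R : R)).
  under eq_fun do rewrite crossingsE//.
  have mlt i : measurable_fun setT (fun z : (width (cls j)).-tuple R *
    (width (cls j)).-tuple (\bar R) => (w%:E < tnth z.2 i + (tnth z.1 i)%:E)%E).
    apply: measurable_fun_lte; first exact: measurable_cst.
    apply: emeasurable_funD.
      by apply: (measurableT_comp (f := fun t => tnth t i)); [exact: measurable_tnth|].
    apply/measurable_EFinP.
    by apply: (measurableT_comp (f := fun t => tnth t i)); [exact: measurable_tnth|].
  apply: (@measurable_cross R _ _ 'I_(width (cls j))
    (fun i (z : (width (cls j)).-tuple R * (width (cls j)).-tuple (\bar R)) =>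
      ((tnth z.2 i <= w%:E)%E && (w%:E < tnth z.2 i + (tnth z.1 i)%:E)%E)%:R)
    (fun i z => (w%:E < tnth z.2 i + (tnth z.1 i)%:E)%E%:R)) => i.
    apply: measurable_natr_bool; apply: measurable_and => //.
    apply: measurable_fun_lee; last exact: measurable_cst.
    by apply: (measurableT_comp (f := fun t => tnth t i)); [exact: measurable_tnth|].
  exact: measurable_natr_bool.
move/measurable_EFinP in mc.
rewrite fubini_tonelli1//=.
apply: ge0_ae_eq_integral => //=.
- exact: measurable_fun_fubini_tonelli_F.
- by apply/measurable_EFinP; exact: measurable_crossing_mean.
- by move=> xi _; apply: integral_ge0 => W _; rewrite lee_fin.
- by move=> xi _; rewrite lee_fin; have /andP[] := crossing_mean_itv k xi xX w0.
- have := ae_probability1 mP xi0.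
  apply: (@filterS _ _ (ae_filter_ringOfSetsType P)) => xi Hxi _.
  exact: integral_crossings.
Qed.

End ClassMeans.

(** * Monotonicity and perturbation of mean crossings *)

Section MeanInequalities.
Context (R : realType).
Implicit Types (x y z : R -> R) (w v : R) (c : job_class R).

(** The conditional mean number of crossings if completions cancelled nothing. *)
Definition increment_sum x w n (xi : n.-tuple R) : R :=
  \sum_(i <- enum 'I_n) (size_tail x w xi i - x w).

Definition mean_increments c x w : R :=
  \int[size_law c]_xi increment_sum x w xi.

Lemma increment_sum_itv x w n (xi : n.-tuple R) : in_X x -> 0 <= w ->
  0 <= increment_sum x w xi <= n%:R * (1 - x w).
Proof.
move=> xX w0; rewrite /increment_sum; apply/andP; split.
  by apply: sumr_ge0 => i _; rewrite subr_ge0 size_tail_ge.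
apply: le_trans (_ : \sum_(i <- enum 'I_n) (1 - x w) <= _).
  by apply: ler_sum => i _; have /andP[_ ?] := size_tail_itv w xi i xX; rewrite lerD2r.
by rewrite big_enum/= sumr_const card_ord mulr_natl.
Qed.

Lemma measurable_increment_sum x w n : in_X x ->
  measurable_fun setT (fun xi : n.-tuple R => increment_sum x w xi).
Proof.
move=> xX; apply: measurable_sum => i.
by apply: measurable_funB; [exact: measurable_size_tail|exact: measurable_cst].
Qed.

Lemma integrable_increment_sum x w n (P : probability (n.-tuple R) R) :
  in_X x -> 0 <= w ->
  P.-integrable setT (EFin \o (fun xi : n.-tuple R => increment_sum x w xi)).
Proof.
move=> xX w0; apply: (@probability_bounded_integrable _ _ _ _ _ (n%:R * (1 - x w))).
  exact: measurable_increment_sum.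
by move=> xi; have /andP[? ?] := increment_sum_itv xi xX w0; rewrite ger0_norm.
Qed.

Lemma integrable_crossing_mean k x w n (P : probability (n.-tuple R) R) :
  in_X x -> 0 <= w ->
  P.-integrable setT (EFin \o (fun xi : n.-tuple R => crossing_mean k x w xi)).
Proof.
move=> xX w0; apply: (@probability_bounded_integrable _ _ _ _ _ n%:R).
  exact: measurable_crossing_mean.
by move=> xi; have /andP[? ?] := crossing_mean_itv k xi xX w0; rewrite ger0_norm.
Qed.

Lemma mean_increments_ge0 c x w : in_X x -> 0 <= w -> 0 <= mean_increments c x w.
Proof.
move=> xX w0; apply: Rintegral_ge0 => xi _.
by have /andP[] := increment_sum_itv xi xX w0.
Qed.

Lemma mean_crossings_ge0 c x w : in_X x -> 0 <= w -> 0 <= mean_crossings c x w.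
Proof.
move=> xX w0; apply: Rintegral_ge0 => xi _.
by have /andP[] := crossing_mean_itv (needed c) xi xX w0.
Qed.

Section Compare.
Context (c : job_class R).
Let n := width c.
Let P := size_law c.

Lemma integrableZl_class (f : n.-tuple R -> R) (r : R) :
  P.-integrable setT (EFin \o f) ->
  P.-integrable setT (EFin \o (fun xi => r * f xi)).
Proof. exact: (integrableZl measurableT r). Qed.

Lemma integrableD_class (f g : n.-tuple R -> R) :
  P.-integrable setT (EFin \o f) -> P.-integrable setT (EFin \o g) ->
  P.-integrable setT (EFin \o (fun xi => f xi + g xi)).
Proof. exact: (integrableD measurableT). Qed.

Lemma Rintegral_cst_class (r : R) : \int[P]_xi r = r.
Proof.
rewrite Rintegral_cst// -[RHS]mulr1; congr (_ * _).
exact: (congr1 fine (probability_setT P)).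
Qed.

Lemma Rintegral_linear (f g : n.-tuple R -> R) (r s : R) :
  P.-integrable setT (EFin \o f) -> P.-integrable setT (EFin \o g) ->
  \int[P]_xi (r * f xi + s * g xi) = r * \int[P]_xi f xi + s * \int[P]_xi g xi.
Proof.
move=> If Ig.
by rewrite RintegralD ?RintegralZl//; exact: integrableZl_class.
Qed.

Lemma mean_crossings_compare x x1 x2 w w1 w2 (C1 C2 b1 b2 : R) :
  in_X x -> in_X x1 -> in_X x2 -> 0 <= w -> 0 <= w1 -> 0 <= w2 ->
  0 <= C1 -> 0 <= C2 -> 0 <= b1 -> 0 <= b2 ->
  (forall s, 0 <= s -> tail_ext x (w - s) - x w <=
     C1 * (tail_ext x1 (w1 - s) - x1 w1) + C2 * (tail_ext x2 (w2 - s) - x2 w2)) ->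
  (forall s, 0 <= s -> tail_ext x (w - s) <= tail_ext x1 (w1 - s) + b1) ->
  (forall s, 0 <= s -> tail_ext x (w - s) <= tail_ext x2 (w2 - s) + b2) ->
  mean_crossings c x w <=
    C1 * (mean_crossings c x1 w1 + b1 * n%:R * mean_increments c x1 w1) +
    C2 * (mean_crossings c x2 w2 + b2 * n%:R * mean_increments c x2 w2).
Proof.
move=> xX x1X x2X w0 w10 w20 C10 C20 b10 b20 ee aa1 aa2.
have I1 := integrable_crossing_mean (needed c) P x1X w10.
have I2 := integrable_crossing_mean (needed c) P x2X w20.
have J1 := integrable_increment_sum P x1X w10.
have J2 := integrable_increment_sum P x2X w20.
rewrite /mean_crossings /mean_increments -/n -/P.
set F1 := (\int[P]_xi _ + _ * (\int[P]_xi increment_sum x1 w1 xi)).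
set F2 := (\int[P]_xi _ + _ * (\int[P]_xi increment_sum x2 w2 xi)).
have -> : F1 = \int[P]_xi (1 * crossing_mean (needed c) x1 w1 xi +
    b1 * n%:R * increment_sum x1 w1 xi) by rewrite Rintegral_linear// mul1r.
have -> : F2 = \int[P]_xi (1 * crossing_mean (needed c) x2 w2 xi +
    b2 * n%:R * increment_sum x2 w2 xi) by rewrite Rintegral_linear// mul1r.
rewrite -Rintegral_linear; last 2 first.
- by apply: integrableD_class; exact: integrableZl_class.
- by apply: integrableD_class; exact: integrableZl_class.
apply: le_Rintegral => //.
- exact: integrable_crossing_mean.
- apply: integrableD_class; apply: integrableZl_class;
    by apply: integrableD_class; exact: integrableZl_class.
move=> xi _; rewrite !mul1r.
have max0 i : 0 <= Num.max 0 (tnth xi i) by rewrite le_max lexx.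
have -> : n%:R = (size (enum 'I_n))%:R :> R by rewrite size_enum_ord.
apply: cross_compare => //.
- by move=> i; exact: size_tail_itv.
- by move=> i; exact: size_tail_itv.
- by move=> i; exact: size_tail_itv.
- by move=> i; rewrite subr_ge0 size_tail_ge.
- by move=> i; rewrite subr_ge0 size_tail_ge.
- by move=> i; exact: ee.
- by move=> i; exact: aa1.
- by move=> i; exact: aa2.
Qed.

Lemma mean_crossings_add_cst x x1 w w1 (b : R) :
  in_X x -> in_X x1 -> 0 <= w -> 0 <= w1 -> 0 <= b ->
  x1 w1 <= x w + b ->
  (forall s, 0 <= s -> tail_ext x (w - s) <= tail_ext x1 (w1 - s)) ->
  mean_crossings c x w <= mean_crossings c x1 w1 + b * n%:R.
Proof.
move=> xX x1X w0 w10 b0 xb aa.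
have I1 := integrable_crossing_mean (needed c) P x1X w10.
have Ic : P.-integrable setT (EFin \o (fun=> 1 : R)).
  apply: (@probability_bounded_integrable _ _ _ _ _ 1) => // z.
  by rewrite normr1.
have -> : mean_crossings c x1 w1 + b * n%:R =
  \int[P]_xi (1 * crossing_mean (needed c) x1 w1 xi + b * n%:R * 1).
  by rewrite Rintegral_linear// mul1r Rintegral_cst_class mulr1.
apply: le_Rintegral => //.
- exact: integrable_crossing_mean.
- by apply: integrableD_class; exact: integrableZl_class.
move=> xi _; rewrite mul1r mulr1.
have max0 i : 0 <= Num.max 0 (tnth xi i) by rewrite le_max lexx.
have -> : n%:R = (size (enum 'I_n))%:R :> R by rewrite size_enum_ord.
apply: cross_add_cst => //.
- by move=> i; exact: size_tail_itv.
- by move=> i; exact: size_tail_itv.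
- by move=> i; rewrite subr_ge0 size_tail_ge.
- by move=> i; have := aa _ (max0 i); rewrite /size_tail; lra.
- by move=> i; exact: aa.
Qed.

Lemma mean_crossings_le x w : in_X x -> 0 <= w ->
  mean_crossings c x w <= n%:R * (1 - x w).
Proof.
move=> xX w0; rewrite /mean_crossings.
have -> : n%:R * (1 - x w) = \int[P]_xi (n%:R * (1 - x w)).
  by rewrite Rintegral_cst_class.
apply: le_Rintegral => //.
- exact: integrable_crossing_mean.
- apply: (@probability_bounded_integrable _ _ _ _ _ `|n%:R * (1 - x w)|) => // z.
move=> xi _; have [_ H] := @cross_bounds _ _ (size_tail x w xi)
  (fun i => size_tail_itv w xi i xX) (fun i => size_tail x w xi i - x w)
  (fun i => ltac:(rewrite subr_ge0; exact: size_tail_ge)) (enum 'I_n) (needed c).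
by apply: le_trans H _; have /andP[_] := increment_sum_itv xi xX w0.
Qed.

(** At a common level the differences of the tails are differences of chances to cross. By linearity
    they add a [cross] of their own, bounded below by [cross_ge_sum]. Equal rates at a contact thus
    force equal increments. *)
Lemma mean_crossings_gap x y w v (m : R) :
  in_X x -> in_X y -> 0 <= w -> 0 <= v -> 0 <= m -> m <= y v -> y v = x w ->
  (0 < needed c)%N ->
  (forall s, 0 <= s -> tail_ext y (v - s) <= tail_ext x (w - s)) ->
  mean_crossings c y v +
    m ^+ n * (mean_increments c x w - mean_increments c y v) <=
  mean_crossings c x w.
Proof.
move=> xX yX w0 v0 m0 my yx k0 aa.
have y1 : y v <= 1 by have [_ _ /(_ _ v0) /andP[]] := yX.
have Ix := integrable_crossing_mean (needed c) P xX w0.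
have Iy := integrable_crossing_mean (needed c) P yX v0.
have Jx := integrable_increment_sum P xX w0.
have Jy := integrable_increment_sum P yX v0.
rewrite /mean_crossings /mean_increments -/P.
have -> : \int[P]_xi increment_sum x w xi - \int[P]_xi increment_sum y v xi =
  \int[P]_xi (1 * increment_sum x w xi + (-1) * increment_sum y v xi).
  by rewrite Rintegral_linear// mul1r mulN1r.
have JJ : P.-integrable setT (EFin \o
   (fun xi => 1 * increment_sum x w xi + (-1) * increment_sum y v xi)).
  by apply: integrableD_class; exact: integrableZl_class.
rewrite -[X in X + _]mul1r -Rintegral_linear//.
apply: le_Rintegral => //.
  by apply: integrableD_class; exact: integrableZl_class.
move=> xi _; rewrite !mul1r mulN1r.
have max0 i : 0 <= Num.max 0 (tnth xi i) by rewrite le_max lexx.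
set r := enum 'I_n.
pose ax := size_tail x w xi; pose ay := size_tail y v xi.
have ax01 i : 0 <= ax i <= 1 by exact: size_tail_itv.
have ay01 i : 0 <= ay i <= 1 by exact: size_tail_itv.
have ayx i : ay i <= ax i by exact: aa.
pose D i := ax i - ay i.
have D0 i : 0 <= D i by rewrite subr_ge0.
have ex0 i : 0 <= ax i - x w by rewrite subr_ge0 size_tail_ge.
have -> : increment_sum x w xi - increment_sum y v xi = \sum_(i <- r) D i.
  rewrite /increment_sum -sumrB; apply: eq_bigr => i _.
  by rewrite yx /D /ax /ay; ring.
have H1 : m ^+ n * \sum_(i <- r) D i <= cross D ay r (needed c).
  have szr : size r = n by rewrite size_enum_ord.
  rewrite -[in X in m ^+ X]szr.
  apply: cross_ge_sum => //; first by rewrite m0 (le_trans my).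
  by move=> i; apply: le_trans my _; exact: size_tail_ge.
have H2 : cross (fun i => (ay i - y v) + 1 * D i) ay r (needed c) =
    crossing_mean (needed c) y v xi + cross D ay r (needed c).
  by rewrite cross_linear mul1r.
have H3 : cross (fun i => (ay i - y v) + 1 * D i) ay r (needed c) =
    cross (fun i => ax i - x w) ay r (needed c).
  by apply: eq_cross => // i; rewrite yx /D; ring.
have H4 : cross (fun i => ax i - x w) ay r (needed c) <= crossing_mean (needed c) x w xi.
  have := @cross_perturb _ _ (fun i => ax i - x w) ax ay 0 r (needed c) ax01 ay01 ex0 (lexx _).
  by rewrite !mul0r addr0; apply => i; rewrite addr0.
lra.
Qed.

Lemma mean_crossings_ge x w : in_X x -> 0 <= w -> (0 < needed c)%N ->
  x w ^+ n * mean_increments c x w <= mean_crossings c x w.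
Proof.
move=> xX w0 k0; have /andP[x0 x1] : 0 <= x w <= 1 by case: xX => _ _; apply.
have Ix := integrable_crossing_mean (needed c) P xX w0.
have Jx := integrable_increment_sum P xX w0.
rewrite /mean_crossings /mean_increments -RintegralZl//.
apply: le_Rintegral => //; first exact: integrableZl_class.
move=> xi _; have szr : size (enum 'I_n) = n by rewrite size_enum_ord.
rewrite -[in X in _ ^+ X]szr; apply: cross_ge_sum => //.
- by move=> i; exact: size_tail_itv.
- by move=> i; rewrite subr_ge0 size_tail_ge.
- by rewrite x0.
- by move=> i; exact: size_tail_ge.
Qed.

End Compare.

End MeanInequalities.

Section ClassFacts.
Context (R : realType).
Implicit Types (x y : R -> R) (w v : R) (c : job_class R).

Lemma valid_class_ae_ge0 c : valid_class c ->
  {ae size_law c, forall t, forall i, 0 <= tnth t i}.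
Proof.
by move=> [_ _]; apply: ae_probability1; exact: measurable_orthant.
Qed.

(** All [F m] vanish almost surely at once, being countably many; if this excluded positive sizes,
    the mean size would be [0]. A single size vector serves all levels [m]. *)
Lemma exists_positive_size c (F : nat -> (width c).-tuple R -> R) :
  valid_class c -> (0 < width c)%N -> (0 < mean_size c)%E ->
  (forall m, measurable_fun setT (F m)) -> (forall m t, 0 <= F m t) ->
  (forall m, (size_law c).-integrable setT (EFin \o F m)) ->
  (forall m, \int[size_law c]_t F m t <= 0) ->
  exists t, (exists i, 0 < tnth t i) /\ forall m, F m t = 0.
Proof.
move=> vc d0 mpos mF F0 IF leF; apply: contrapT => nex.
have aeF m : {ae size_law c, forall t, F m t = 0}.
  have F00 : (\int[size_law c]_t `|(F m t)%:E| = 0)%E.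
    transitivity (\int[size_law c]_t F m t)%:E.
      rewrite /Rintegral fineK; last by apply: integrable_fin_num => //; exact: IF.
      by apply: eq_integral => t _; rewrite gee0_abs ?lee_fin.
    congr EFin; apply/le_anti; rewrite leF andTb.
    by apply: Rintegral_ge0 => t _; exact: F0.
  have : ae_eq (size_law c) setT (EFin \o F m) (cst 0%E).
    by apply/ae_eq_integral_abs => //; exact/measurable_EFinP.
  apply: (@filterS _ _ (ae_filter_ringOfSetsType (size_law c))) => t /(_ I)/=.
  by case.
move: mpos; rewrite /mean_size.
have nthE (t : (width c).-tuple R) : t`_0 = tnth t (Ordinal d0) by rewrite (tnth_nth 0).
under eq_integral do rewrite nthE.
rewrite (ae_eq_integral (cst 0%E)) ?integral0 ?ltxx//.
  by apply/measurable_EFinP; exact: measurable_tnth.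
have := ae_foralln aeF.
move: (valid_class_ae_ge0 vc).
apply: (@filterS2 _ _ (ae_filter_ringOfSetsType (size_law c))) => t t0 Ft _ /=.
congr EFin; apply/le_anti; rewrite t0 andbT leNgt; apply/negP => tpos.
by apply: nex; exists t; split => //; exists (Ordinal d0).
Qed.

End ClassFacts.

Section SingleServerSubClass.
Context (R : realType).
Implicit Types (x y : R -> R) (w v : R) (c : job_class R).

Lemma measurable_permute_coords n (s : 'S_n) :
  measurable_fun setT (@permute_coords R n s).
Proof.
apply/measurable_fun_tnthP => i.
rewrite (_ : _ \o _ = @tnth n R ^~ (s i)); first exact: measurable_tnth.
by apply/funext => t /=; rewrite tnth_mktuple.
Qed.

Lemma exchangeable_Rintegral n (F : probability (n.-tuple R) R) (g : R -> R) i j :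
  exchangeable F -> measurable_fun setT g -> (forall u, 0 <= g u) ->
  \int[F]_t g (tnth t i) = \int[F]_t g (tnth t j).
Proof.
move=> exF mg g0; congr fine.
have mgt l : measurable_fun setT (fun t : n.-tuple R => (g (tnth t l))%:E).
  by apply/measurable_EFinP; apply: measurableT_comp mg _; exact: measurable_tnth.
transitivity (\int[pushforward F (permute_coords (tperm i j))]_t (g (tnth t i))%:E)%E.
  apply: eq_measure_integral; first exact: measurable_permute_coords.
  by move=> mp A mA _; exact: (esym (exF (tperm i j) A mA)).
rewrite ge0_integral_pushforward//=.
- by apply: eq_integral => t _ /=; rewrite tnth_mktuple tpermL.
- exact: measurable_permute_coords.
- by move=> t _; rewrite lee_fin.
Qed.

(** With a single server nothing is cancelled before its own completion, and by exchangeability all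
    coordinates contribute equally to [mean_increments]. *)
Lemma mean_crossings_sub1 c (m : 'I_(width c).+1) x w : valid_class c ->
  nat_of_ord m = 1%N -> in_X x -> 0 <= w ->
  (width c)%:R * mean_crossings (sub_class m) x w = mean_increments c x w.
Proof.
move=> [kd exc _] m1 xX w0.
have d0 : (0 < width c)%N by rewrite -m1 -ltnS ltn_ord.
have k0 : (0 < needed c)%N by case: kd => [/andP[]//|[_ E]]; rewrite E in d0.
pose g (u : R) := tail_ext x (w - Num.max 0 u) - x w.
have g0 u : 0 <= g u.
  rewrite /g subr_ge0 -[leLHS](tail_ext_ge0 x w0).
  apply: tail_ext_nonincreasing => //.
  by rewrite gerBl le_max lexx.
have mtg : measurable_fun setT g.
  apply: measurable_funB; last exact: measurable_cst.
  have := @measurable_size_tail R x w 1 ord0 xX => H.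
  rewrite (_ : (fun u => _) = (fun xi : 1.-tuple R => size_tail x w xi ord0) \o
    (fun u : R => [tuple u])).
    apply: measurableT_comp => //; apply/measurable_fun_tnthP => i.
    rewrite (_ : _ \o _ = id); first exact: measurable_id.
    by apply/funext => u; rewrite ord1.
  by apply/funext => u; rewrite /size_tail/=.
pose i0 := Ordinal d0.
have cmE (t : m.-tuple R) (l : 'I_m) :
    crossing_mean (minn (needed c) m) x w t = g (tnth t l).
  have k1 : minn (needed c) m = 1%N by rewrite m1; exact/minn_idPr.
  rewrite k1 /crossing_mean.
  have -> : enum 'I_m = [:: l].
    apply: perm_small_eq => //.
    apply: uniq_perm; rewrite ?enum_uniq// => j.
    have -> : j = l.
      apply: val_inj => /=.
      have := ltn_ord j; have := ltn_ord l.
      move: (nat_of_ord l) (nat_of_ord j) => a b; rewrite m1 !ltnS !leqn0.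
      by move=> /eqP -> /eqP ->.
    by rewrite mem_enum mem_head.
  by rewrite /= mulr0 mulr0 !add0r mulr1.
have l0 : (0 < m)%N by rewrite m1.
have -> : mean_crossings (sub_class m) x w = \int[size_law c]_xi g (tnth xi i0).
  rewrite /mean_crossings /=; congr fine.
  rewrite ge0_integral_distribution//=; last 2 first.
  - by apply/measurable_EFinP; exact: measurable_crossing_mean.
  - by move=> t; rewrite lee_fin; have /andP[] := crossing_mean_itv (minn (needed c) m) t xX w0.
  apply: eq_integral => t _ /=; rewrite (cmE _ (Ordinal l0)) /proj_tuple tnth_mktuple.
  by congr ((g (tnth _ _))%:E); exact: val_inj.
have Ig i : (size_law c).-integrable setT (EFin \o (fun xi => g (tnth xi i))).
  apply: (@probability_bounded_integrable _ _ _ _ _ 1).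
    by apply: measurableT_comp mtg _; exact: measurable_tnth.
  move=> xi; rewrite ger0_norm// /g.
  have /andP[_ ?] := tail_ext_itv (w - Num.max 0 (tnth xi i)) xX.
  by have [_ _ /(_ w w0) /andP[? _]] := xX; lra.
have sumE (r : seq 'I_(width c)) :
    (size_law c).-integrable setT (EFin \o (fun xi => \sum_(i <- r) g (tnth xi i))) /\
    \int[size_law c]_xi \sum_(i <- r) g (tnth xi i) =
    (size r)%:R * \int[size_law c]_xi g (tnth xi i0).
  elim: r => [|i r [IHi IH]].
    have -> : (fun xi => \sum_(i <- [::]) g (tnth xi i)) = (fun=> 0) :> ((width c).-tuple R -> R).
      by apply/funext => xi; rewrite big_nil.
    rewrite Rintegral_cst_class mul0r; split => //.
    by apply: (@probability_bounded_integrable _ _ _ _ _ 0) => // z; rewrite normr0.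
  have -> : (fun xi => \sum_(l <- i :: r) g (tnth xi l)) =
      (fun xi => g (tnth xi i) + \sum_(l <- r) g (tnth xi l)) :> ((width c).-tuple R -> R).
    by apply/funext => xi; rewrite big_cons.
  split; first exact: integrableD_class.
  rewrite RintegralD// IH (exchangeable_Rintegral i i0 exc mtg g0) /=.
  by rewrite -addn1 natrD; ring.
by rewrite /mean_increments /increment_sum (sumE (enum 'I_(width c))).2 size_enum_ord.
Qed.

End SingleServerSubClass.

Section RightContinuity.
Context (R : realType).
Implicit Types (x y : R -> R) (w v : R) (c : job_class R).

Lemma cvg_few (I : Type) (a : nat -> I -> R) (a' : I -> R) r k :
  (forall i, a n i @[n --> \oo] --> a' i) ->
  few (a n) r k @[n --> \oo] --> few a' r k.
Proof.
move=> ca; elim: r k => [|i r IH] k /=; first exact: cvg_cst.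
by apply: cvgD; apply: cvgM => //; apply: cvgB => //; exact: cvg_cst.
Qed.

Lemma cvg_cross (I : Type) (e a : nat -> I -> R) (e' a' : I -> R) r k :
  (forall i, e n i @[n --> \oo] --> e' i) ->
  (forall i, a n i @[n --> \oo] --> a' i) ->
  cross (e n) (a n) r k @[n --> \oo] --> cross e' a' r k.
Proof.
move=> ce ca; elim: r k => [|i r IH] k /=; first exact: cvg_cst.
apply: cvgD; last by apply: cvgM => //; exact: cvg_few.
by apply: cvgD; apply: cvgM => //; apply: cvgB => //; exact: cvg_cst.
Qed.

Lemma tail_ext_right_continuous x v : in_X x ->
  tail_ext x u @[u --> v^'+] --> tail_ext x v.
Proof.
move=> [_ xr _]; have [v0|v0] := ltP v 0.
  rewrite /tail_ext v0; apply: cvg_near_cst; near=> u.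
  by rewrite ifT//; near: u; exact: nbhs_right_lt.
rewrite tail_ext_ge0//; apply: cvg_trans (xr v v0); apply: near_eq_cvg.
near=> u; rewrite tail_ext_ge0//; apply: le_trans v0 _.
by near: u; exact: nbhs_right_ge.
Unshelve. all: by end_near. Qed.

(** Dominated convergence, the width being the bound. Continuity from the left can fail: if a size
    has an atom at [w], the tail at [w - xi_i] jumps from [1] to [x 0]. *)
Lemma mean_crossings_right_continuous c x w : in_X x -> 0 <= w ->
  mean_crossings c x u @[u --> w^'+] --> mean_crossings c x w.
Proof.
move=> xX w0; apply/cvg_at_rightP => u [uw cu].
have u0 n : 0 <= u n by rewrite ltW// (le_lt_trans w0).
have cte s : tail_ext x (u n - s) @[n --> \oo] --> tail_ext x (w - s).
  have /cvg_at_rightP := @tail_ext_right_continuous x (w - s) xX; apply; split.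
    by move=> n; rewrite ltrD2r.
  by apply: cvgB => //; exact: cvg_cst.
have cx : x (u n) @[n --> \oo] --> x w.
  have := cte 0; rewrite subr0 tail_ext_ge0//; apply: cvg_trans; apply: near_eq_cvg.
  by near=> n; rewrite subr0 tail_ext_ge0.
have mc v : measurable_fun setT (fun xi : (width c).-tuple R =>
    (crossing_mean (needed c) x v xi)%:E).
  by apply/measurable_EFinP; exact: measurable_crossing_mean.
have [|||||_ _ H] := @dominated_convergence _ _ R (size_law c) setT measurableT
  (fun n xi => (crossing_mean (needed c) x (u n) xi)%:E)
  (fun xi => (crossing_mean (needed c) x w xi)%:E) (fun=> ((width c)%:R)%:E).
- by move=> n; exact: mc.
- exact: mc.
- apply: aeW => xi _; apply: cvg_EFin; first exact: nearW.
  by apply: cvg_cross => i; [apply: cvgB => //; exact: cte|exact: cte].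
- apply: (@probability_bounded_integrable _ _ _ _ (fun=> (width c)%:R) (width c)%:R) => // z.
  by rewrite ger0_norm.
- apply: aeW => xi n _; rewrite gee0_abs lee_fin;
    by have /andP[] := crossing_mean_itv (needed c) xi xX (u0 n).
apply: fine_cvg.
rewrite /mean_crossings /Rintegral fineK; last first.
  by apply: integrable_fin_num => //; exact: integrable_crossing_mean.
exact: H.
Unshelve. all: by end_near. Qed.

End RightContinuity.

(** * Crossing rates and DE-FPs *)

Section Rates.
Context (R : realType) (J : finType) (cls : J -> job_class R).
Implicit Types (x y : R -> R) (w v lam : R) (p : J -> R).

Definition rate lam p x w : R := lam * \sum_j p j * mean_crossings (cls j) x w.

(** Unweighted, hence one unit common to both sets of parameters. *)
Definition total_increments x w : R := \sum_j mean_increments (cls j) x w.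

Lemma rateE lam p x w : (forall j, valid_class (cls j)) -> in_X x -> 0 <= w ->
  (lam%:E * expected_crossings cls p x w = (rate lam p x w)%:E)%E.
Proof.
move=> vc xX w0; rewrite EFinM; congr (_ * _)%E.
rewrite /expected_crossings -sumEFin.
by apply: eq_bigr => j _; rewrite class_crossingsE// EFinM.
Qed.

Lemma mean_increments_le_total x w j : in_X x -> 0 <= w ->
  mean_increments (cls j) x w <= total_increments x w.
Proof.
move=> xX w0; rewrite /total_increments (bigD1 j)//= lerDl.
by apply: sumr_ge0 => i _; exact: mean_increments_ge0.
Qed.

Section FixedParameters.
Context (lam : R) (p : J -> R).
Hypotheses (lam0 : 0 <= lam) (p0 : forall j, 0 <= p j).
Notation alpha := (total_load cls lam p).

Lemma total_load_ge0 : 0 <= alpha.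
Proof. by rewrite mulr_ge0// sumr_ge0// => j _; rewrite mulr_ge0. Qed.

Lemma rate_ge0 x w : in_X x -> 0 <= w -> 0 <= rate lam p x w.
Proof.
move=> xX w0; rewrite mulr_ge0// sumr_ge0// => j _.
by rewrite mulr_ge0// mean_crossings_ge0.
Qed.

Lemma rate_compare x x1 x2 w w1 w2 (C1 C2 b1 b2 : R) :
  in_X x -> in_X x1 -> in_X x2 -> 0 <= w -> 0 <= w1 -> 0 <= w2 ->
  0 <= C1 -> 0 <= C2 -> 0 <= b1 -> 0 <= b2 ->
  (forall s, 0 <= s -> tail_ext x (w - s) - x w <=
     C1 * (tail_ext x1 (w1 - s) - x1 w1) + C2 * (tail_ext x2 (w2 - s) - x2 w2)) ->
  (forall s, 0 <= s -> tail_ext x (w - s) <= tail_ext x1 (w1 - s) + b1) ->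
  (forall s, 0 <= s -> tail_ext x (w - s) <= tail_ext x2 (w2 - s) + b2) ->
  rate lam p x w <=
    C1 * (rate lam p x1 w1 + b1 * alpha * total_increments x1 w1) +
    C2 * (rate lam p x2 w2 + b2 * alpha * total_increments x2 w2).
Proof.
move=> xX x1X x2X w0 w10 w20 C10 C20 b10 b20 ee aa1 aa2.
(* Replacing the increments of each class by the total leaves the sum of [p j] times the widths,
   which is [alpha] up to the factor [lam]. *)
have H z u (b : R) : in_X z -> 0 <= u -> 0 <= b ->
   lam * \sum_j p j * (mean_crossings (cls j) z u + b * (width (cls j))%:R *
     mean_increments (cls j) z u) <=
   rate lam p z u + b * alpha * total_increments z u.
  move=> zX u0 b0.
  apply: le_trans (_ : lam * \sum_j (p j * mean_crossings (cls j) z u +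
      b * total_increments z u * (p j * (width (cls j))%:R)) <= _).
    rewrite ler_wpM2l//; apply: ler_sum => j _.
    rewrite mulrDr lerD2l.
    have := mean_increments_le_total j zX u0.
    move=> /(ler_wpM2l (_ : 0 <= b * (p j * (width (cls j))%:R))) H.
    apply: le_trans (_ : b * (p j * (width (cls j))%:R) * mean_increments (cls j) z u <= _).
      by rewrite le_eqVlt; apply/orP; left; apply/eqP; ring.
    apply: le_trans (H _) _; first by rewrite !mulr_ge0.
    by rewrite le_eqVlt; apply/orP; left; apply/eqP; ring.
  rewrite big_split/= -mulr_sumr /rate /total_load mulrDr lerD2l.
  by rewrite le_eqVlt; apply/orP; left; apply/eqP; ring.
apply: le_trans (_ : lam * \sum_j p j * (
  C1 * (mean_crossings (cls j) x1 w1 + b1 * (width (cls j))%:R *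
     mean_increments (cls j) x1 w1) +
  C2 * (mean_crossings (cls j) x2 w2 + b2 * (width (cls j))%:R *
     mean_increments (cls j) x2 w2)) <= _).
  rewrite ler_wpM2l//; apply: ler_sum => j _; rewrite ler_wpM2l//.
  exact: mean_crossings_compare.
have H1 := ler_wpM2l C10 (H _ _ _ x1X w10 b10).
have H2 := ler_wpM2l C20 (H _ _ _ x2X w20 b20).
apply: le_trans (lerD H1 H2); rewrite le_eqVlt; apply/orP; left; apply/eqP.
rewrite !mulrA ![_ * lam]mulrC -!mulrA -mulrDr; congr (_ * _).
rewrite !mulr_sumr -big_split/=; apply: eq_bigr => j _; ring.
Qed.

Lemma rate_add_cst x x1 w w1 (b : R) :
  in_X x -> in_X x1 -> 0 <= w -> 0 <= w1 -> 0 <= b -> x1 w1 <= x w + b ->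
  (forall s, 0 <= s -> tail_ext x (w - s) <= tail_ext x1 (w1 - s)) ->
  rate lam p x w <= rate lam p x1 w1 + b * alpha.
Proof.
move=> xX x1X w0 w10 b0 xb aa.
apply: le_trans (_ : lam * \sum_j p j *
   (mean_crossings (cls j) x1 w1 + b * (width (cls j))%:R) <= _).
  rewrite ler_wpM2l//; apply: ler_sum => j _; rewrite ler_wpM2l//.
  exact: mean_crossings_add_cst.
rewrite le_eqVlt; apply/orP; left; apply/eqP.
rewrite /rate /total_load mulrCA -mulrDr; congr (_ * _).
by rewrite mulr_sumr -big_split/=; apply: eq_bigr => j _; ring.
Qed.

Lemma rate_le x w : in_X x -> 0 <= w -> rate lam p x w <= alpha * (1 - x w).
Proof.
move=> xX w0; rewrite /rate /total_load -mulrA ler_wpM2l// mulr_suml.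
apply: ler_sum => j _; rewrite -mulrA ler_wpM2l//.
exact: mean_crossings_le.
Qed.

Lemma rate_gap x y w v (m : R) j :
  in_X x -> in_X y -> 0 <= w -> 0 <= v -> 0 <= m -> m <= y v -> y v = x w ->
  (0 < needed (cls j))%N ->
  (forall s, 0 <= s -> tail_ext y (v - s) <= tail_ext x (w - s)) ->
  rate lam p y v + lam * p j * m ^+ width (cls j) *
    (mean_increments (cls j) x w - mean_increments (cls j) y v) <=
  rate lam p x w.
Proof.
move=> xX yX w0 v0 m0 my yx k0 aa.
rewrite /rate -!mulrA -mulrDr ler_wpM2l// (bigD1 j)//= [leRHS](bigD1 j)//=.
rewrite addrAC -mulrDr; apply: lerD.
  by rewrite ler_wpM2l//; exact: mean_crossings_gap.
apply: ler_sum => i _; rewrite ler_wpM2l//.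
have := @mean_crossings_add_cst _ (cls i) y x v w 0 yX xX v0 w0 (lexx _).
by rewrite mul0r !addr0; apply => //; rewrite yx.
Qed.

Lemma rate_ge x w j : in_X x -> 0 <= w -> (0 < needed (cls j))%N ->
  lam * p j * x w ^+ width (cls j) * mean_increments (cls j) x w <= rate lam p x w.
Proof.
move=> xX w0 k0; rewrite /rate -!mulrA ler_wpM2l// (bigD1 j)//=.
apply: le_trans (_ : p j * mean_crossings (cls j) x w <= _).
  by rewrite ler_wpM2l//; exact: mean_crossings_ge.
rewrite lerDl sumr_ge0// => i _; rewrite mulr_ge0//.
exact: mean_crossings_ge0.
Qed.

Lemma rate_right_continuous x w (e : R) : in_X x -> 0 <= w -> 0 < e ->
  exists2 d, 0 < d & forall s, 0 <= s <= d ->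
    `|rate lam p x (w + s) - rate lam p x w| <= e.
Proof.
move=> xX w0 e0.
have : rate lam p x u @[u --> w^'+] --> rate lam p x w.
  apply: cvgM; first exact: cvg_cst.
  apply: (@cvg_big _ _ +%R) => // [|j _]; first exact: add_continuous.
  apply: cvgM; first exact: cvg_cst.
  exact: mean_crossings_right_continuous.
move=> /cvgrPdist_le/(_ e e0)[d /= d0 H].
exists (d / 2); first by rewrite divr_gt0.
move=> s /andP[s0 sd]; move: (s0); rewrite le_eqVlt => /predU1P[<-|sgt0].
  by rewrite addr0 subrr normr0 ltW.
rewrite distrC; apply: H; last by rewrite /= ltrDl.
by rewrite /= distrC addrC addKr ger0_norm//; lra.
Qed.

Lemma lipschitz_total_load x :
  alpha.-lipschitz_(`[0, +oo[) x -> lipschitz_ge 0 alpha x.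
Proof.
move=> lx v w /andP[v0 vw]; have := lx (w, v) => /=.
rewrite [`|w - v|]ger0_norm ?subr_ge0//; apply.
by rewrite /= !in_itv/= !andbT (le_trans v0).
Qed.

Lemma infinite_frame_gt0 x w : in_X x -> infinite_frame x -> 0 <= w -> 0 < x w.
Proof.
move=> [_ _ x01] inf w0; have /andP[xw0 _] := x01 _ w0.
rewrite lt_neqAle xw0 andbT eq_sym; apply/eqP => xw.
have : (frame_size x <= w%:E)%E by apply: ereal_inf_lbound; exists w.
by rewrite inf.
Qed.

(** Just to the right of [w] the rate is within [e] of its value at [w], and so is [-x'] wherever it
    exists; the increment bounds for Lipschitz functions integrate this. *)
Lemma DEFP_right_derivative x w : (forall j, valid_class (cls j)) ->
  is_DEFP cls lam p x -> infinite_frame x -> 0 <= w ->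
  right_derivative x w (- rate lam p x w).
Proof.
move=> vc [xX /lipschitz_total_load lx dx] inf w0 e e0.
have [d d0 Hd] := rate_right_continuous xX w0 e0.
exists d => // s /andP[s0 sd].
have [xd _ _] := xX.
pose F v := - x (Num.max 0 v).
have max_lip (u v : R) : u <= v -> 0 <= Num.max 0 v - Num.max 0 u <= v - u.
  by move=> uv; rewrite /Num.max; case: ifPn; case: ifPn; rewrite -?leNgt; lra.
have maxge (u : R) : 0 <= Num.max 0 u by rewrite le_max lexx.
have maxE (u : R) : 0 <= u -> Num.max 0 u = u by move=> ?; exact/max_r.
have ndF : {homo F : u v / u <= v}.
  move=> u v uv; rewrite /F lerN2; apply: xd; rewrite ?in_itv/= ?andbT//.
  by rewrite -subr_ge0; have /andP[] := max_lip _ _ uv.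
have lF u v : u <= v -> F v - F u <= (alpha + 1) * (v - u).
  move=> uv; have /andP[m1 m2] := max_lip _ _ uv.
  have /lx : 0 <= Num.max 0 u <= Num.max 0 v by rewrite maxge -subr_ge0.
  rewrite ler_norml => /andP[H _]; rewrite /F.
  have := ler_wpM2l total_load_ge0 m2; have : 0 <= v - u by lra.
  lra.
pose r := rate lam p x w.
(* The increment bounds require a positive Lipschitz constant and a nonnegative lower bound, hence
   [alpha + 1] and the truncation of [r - e]. *)
have := @lipschitz_increment_bounds R F (alpha + 1) w (w + s)
  (Num.max 0 (r - e)) (r + e) _ ndF lF.
have -> : w + s - w = s by ring.
rewrite /F (maxE w)// (maxE (w + s)) ?addr_ge0// => H.
have : Num.max 0 (r - e) * s <= - x (w + s) - - x w <= (r + e) * s.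
  apply: H; rewrite ?lerDl ?maxge//; first by have := total_load_ge0; lra.
  move=> v /andP[wv vs] dF.
  have v0 : 0 < v by exact: le_lt_trans wv.
  have nearE : {near v, F =1 - x}.
    near=> u; rewrite /F maxE// ltW//.
    by near: u; exact: lt_nbhsr.
  have dNx : derivable (- x) v 1 by exact: near_eq_derivable nearE dF.
  have dxv : derivable x v 1 by rewrite -[x]opprK; exact: derivableN.
  have -> : 'D_1 F v = - 'D_1 x v by rewrite -deriveN//; exact: near_eq_derive.
  have vinf : (v%:E < frame_size x)%E by rewrite inf ltry.
  have := dx v v0 vinf dxv; rewrite (rateE _ _ vc xX (ltW v0)) => -[->].
  have := Hd (v - w); rewrite subrKC => /(_ _)/=.
  rewrite subr_ge0 (ltW wv) lerBlDl (le_trans (ltW vs)) ?lerD2l// => /(_ isT).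
  rewrite ler_norml => /andP[h1 h2].
  by rewrite ge_max rate_ge0 ?(ltW v0)//=; apply/andP; split; rewrite /r; lra.
move=> /andP[h1 h2]; rewrite ler_norml -/r.
have h3 : (r - e) * s <= Num.max 0 (r - e) * s by rewrite ler_wpM2r// le_max lexx orbT.
by apply/andP; split; lra.
Unshelve. all: by end_near. Qed.

(** [1 - x] grows at a rate at most [alpha * (1 - x)], so by Gronwall's lemma it stays [0] if it
    starts at [0]. *)
Lemma DEFP_lt1 x : (forall j, valid_class (cls j)) ->
  is_DEFP cls lam p x -> infinite_frame x ->
  ~ (forall w, 0 <= w -> x w = 1) -> forall w, 0 <= w -> x w < 1.
Proof.
move=> vc xD inf nx1 w w0.
have [xX /lipschitz_total_load lx _] := xD; have [xd _ x01] := xX.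
suff x01' : x 0 < 1.
  by apply: le_lt_trans x01'; apply: xd; rewrite // in_itv/= ?lexx ?w0.
rewrite ltNge; apply/negP => x0; apply: nx1 => {w w0} w w0.
apply/le_anti; have /andP[_ ->] /= := x01 w w0.
suff : 1 + (-1) * x w <= 0 by lra.
have aK : 0 < alpha + 1 by have := total_load_ge0; lra.
apply: (@gronwall_le0 R (fun v => 1 + (-1) * x v) (rate lam p x) 0 alpha (alpha + 1)) => //.
- move=> u v uv; have := lx _ _ uv; rewrite -normrN.
  by congr (`|_| <= _); ring.
- lra.
- move=> v v0; split.
    rewrite (_ : rate lam p x v = 0 + (-1) * (- rate lam p x v)); last ring.
    apply: right_derivative_linear (right_derivative_cst _ _) _.
    exact: DEFP_right_derivative.
  have := rate_le xX v0; have /andP[_ ?] := x01 v v0; lra.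
Qed.

End FixedParameters.
End Rates.

(** * Slack of the dominating parameters and strict monotonicity *)

Section Slack.
Context (R : realType) (J : finType) (cls : J -> job_class R).
Implicit Types (x y : R -> R) (w v lam : R) (p : J -> R) (c : job_class R).

(** The extra arrivals add at least [g0] times the sum [S] of the mean crossings of all classes. The
    increments of each class are its width times the crossings of its single-server sub-class, a
    term of [S]; the total is therefore at most [N * S]. *)
Lemma rate_slack lam p lamhat phat (j0 : J) :
  (forall j, valid_class (cls j)) -> closed_under_sub_classes cls ->
  (forall j, lam * p j < lamhat * phat j) ->
  exists2 c0 : R, 0 < c0 & forall x w, in_X x -> 0 <= w ->
    rate cls lam p x w + c0 * total_increments cls x w <= rate cls lamhat phat x w.
Proof.
move=> vc closed lt_hat.
pose gap j := lamhat * phat j - lam * p j.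
pose g0 := \big[Order.min/1]_j gap j.
have g00 : 0 < g0 by apply: lt_bigmin => // j _; rewrite subr_gt0.
pose N := \sum_j (width (cls j))%:R : R.
have N0 : 0 <= N by apply: sumr_ge0.
exists (g0 / (N + 1)); first by rewrite divr_gt0//; lra.
move=> x w xX w0; pose S := \sum_j mean_crossings (cls j) x w.
have mc0 j : 0 <= mean_crossings (cls j) x w by exact: mean_crossings_ge0.
have S0 : 0 <= S by exact: sumr_ge0.
have DS : total_increments cls x w <= N * S.
  rewrite /total_increments /N mulr_suml; apply: ler_sum => j _.
  have [d0|] := ltnP 0 (width (cls j)); last first.
    rewrite leqn0 => /eqP d0; rewrite d0 mul0r /mean_increments.
    rewrite (_ : (fun xi => _) = fun=> 0) ?Rintegral_cst_class//.
    apply/funext => xi; rewrite /increment_sum big_enum/= big1// => i.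
    by have := ltn_ord i; rewrite {2}d0.
  have m1 : (1 < (width (cls j)).+1)%N by [].
  have [i iE] := closed j (Ordinal m1).
  rewrite -(@mean_crossings_sub1 _ _ (Ordinal m1))// -iE ler_wpM2l//.
  by rewrite /S (bigD1 i)//= lerDl sumr_ge0.
have gS : g0 * S <= rate cls lamhat phat x w - rate cls lam p x w.
  rewrite /rate !mulr_sumr -sumrB; apply: ler_sum => j _.
  rewrite !mulrA -mulrBl ler_wpM2r//; exact: bigmin_le.
rewrite -lerBrDl; apply: le_trans gS; rewrite mulrAC ler_pdivrMr; last lra.
rewrite -mulrA ler_wpM2l ?(ltW g00)//; apply: le_trans DS _.
by rewrite mulrC ler_wpM2l//; lra.
Qed.

Lemma mean_increments_le c x y w v (C : R) : in_X x -> in_X y -> 0 <= w ->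
  0 <= v -> 0 <= C ->
  (forall s, 0 <= s -> tail_ext x (w - s) - x w <= C * (tail_ext y (v - s) - y v)) ->
  mean_increments c x w <= C * mean_increments c y v.
Proof.
move=> xX yX w0 v0 C0 H.
rewrite /mean_increments -RintegralZl//; last exact: integrable_increment_sum.
apply: le_Rintegral => //; first exact: integrable_increment_sum.
  by apply: integrableZl_class; exact: integrable_increment_sum.
move=> xi _; rewrite /increment_sum mulr_sumr; apply: ler_sum => i _.
by apply: H; rewrite le_max lexx.
Qed.

(** Let [v] be the first level with value [x w]. If the increments at [v] vanished, almost all sizes
    would be [0], because a positive size would lead to an earlier level with the same value or to
    [x v = 1]. So [x] drops right after [v], and [v = w]. *)
Lemma strictly_decreasing x c (g k : R -> R) (M : R) : in_X x ->
  lipschitz_ge 0 M x -> x 0 < 1 -> valid_class c -> (0 < width c)%N ->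
  (0 < mean_size c)%E ->
  (forall w, 0 <= w -> right_derivative x w (- g w)) ->
  (forall w, 0 <= w -> 0 < k w /\ k w * mean_increments c x w <= g w) ->
  forall w, 0 <= w -> 0 < mean_increments c x w /\ (forall v, w < v -> x v < x w).
Proof.
move=> xX lx x01 vc d0 mpos dx gk w w0; have [xd _ _] := xX.
have xle u v : 0 <= u -> u <= v -> x v <= x u.
  by move=> u0 uv; apply: xd; rewrite // in_itv/= ?andbT// (le_trans u0).
have drop v : 0 <= v -> 0 < mean_increments c x v ->
    forall u, v < u -> x u < x v.
  move=> v0 Dv u vu; have [kv gv] := gk v v0.
  have g0 : - g v < 0 by rewrite oppr_lt0; apply: lt_le_trans gv; exact: mulr_gt0.
  have [d d0' H] := right_derivative_lt0 (dx v v0) g0.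
  apply: le_lt_trans (H (Num.min d (u - v)) _).
    apply: xle; first by rewrite addr_ge0// le_min ltW//= subr_ge0 ltW.
    by rewrite -lerBrDl ge_min lexx orbT.
  by rewrite lt_min d0' subr_gt0 vu ge_min lexx.
suff Dw : 0 < mean_increments c x w by split => //; exact: drop.
pose S := [set u | 0 <= u /\ x u = x w].
have Sinf : has_inf S by split; [exists w | exists 0 => u []].
pose v := inf S.
have v0 : 0 <= v by apply: lb_le_inf; [exists w | move=> u []].
have vw : v <= w by apply: ge_inf; [exact: Sinf.2|].
have xv : x v = x w.
  apply/le_anti/andP; split; last exact: xle.
  apply/ler_addgt0Pr => e e0.
  have M0 : 0 < `|M| + 1 by have := normr_ge0 M; lra.
  have [t [t0 xt] tv] := inf_adherent (divr_gt0 e0 M0) Sinf.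
  have vt : v <= t by apply: ge_inf; [exact: Sinf.2|split].
  have := lx v t; rewrite v0 vt => /(_ isT); rewrite ler_norml xt => /andP[H _].
  have : M * (t - v) <= (`|M| + 1) * (e / (`|M| + 1)); last first.
    by rewrite [(_ + 1) * _]mulrC divfK ?gt_eqF//; lra.
  apply: le_trans (_ : (`|M| + 1) * (t - v) <= _).
    by rewrite ler_wpM2r ?subr_ge0//; have := ler_norm M; lra.
  by rewrite ler_pM2l//; move: tv; rewrite -/v; lra.
have Dv : 0 < mean_increments c x v.
  rewrite ltNge; apply/negP => Dle.
  have [||||t [[i ti] H]] := @exists_positive_size R c (fun=> @increment_sum R x v _) vc d0 mpos.
  - by move=> _; exact: measurable_increment_sum.
  - by move=> _ t; have /andP[] := increment_sum_itv t xX v0.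
  - by move=> _; exact: integrable_increment_sum.
  - by move=> _; exact: Dle.
  have := H 0%N; rewrite /increment_sum big_enum/= => /eqP.
  rewrite psumr_eq0 => [/allP/(_ i)|l _]; last by rewrite subr_ge0 size_tail_ge.
  rewrite mem_index_enum => /(_ isT)/=; rewrite subr_eq0 /size_tail.
  have -> : Num.max 0 (tnth t i) = tnth t i by apply/max_r/ltW.
  have [tv|vt] := leP (tnth t i) v.
    rewrite tail_ext_ge0 ?subr_ge0// => /eqP xE.
    have : v <= v - tnth t i.
      by apply: ge_inf; [exact: Sinf.2|split; rewrite ?subr_ge0// xE].
    by rewrite leNgt ltrBlDr ltrDl ti.
  rewrite /tail_ext subr_lt0 vt => /eqP x1.
  by have := xle 0 v (lexx _) v0; rewrite -x1 leNgt x01.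
have [<-//|vltw] : v = w \/ v < w by move: vw; rewrite le_eqVlt => /predU1P.
by have := drop v v0 Dv w vltw; rewrite xv ltxx.
Qed.

End Slack.

(** * Comparison of DE-FPs *)

Section Comparison.
Context (R : realType) (J : finType) (cls : J -> job_class R).
Context (lam : R) (p : J -> R).
Hypotheses (vc : forall j, valid_class (cls j)).
Hypotheses (lam0 : 0 < lam) (p0 : forall j, 0 <= p j).
Implicit Types (x y z : R -> R) (w v : R).
Notation alpha := (total_load cls lam p).
Notation rate := (rate cls lam p).

Let lam0' : 0 <= lam. Proof. exact: ltW. Qed.
Let alpha0 : 0 <= alpha. Proof. exact: total_load_ge0. Qed.

Lemma in_X_nonincreasing x u v : in_X x -> 0 <= u -> u <= v -> x v <= x u.
Proof.
by move=> [xd _ _] u0 uv; apply: xd; rewrite // in_itv/= ?andbT// (le_trans u0).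
Qed.

Lemma in_X_itv x w : in_X x -> 0 <= w -> 0 <= x w <= 1.
Proof. by move=> [_ _]; apply. Qed.

Lemma tail_ext_le1 x w : in_X x -> tail_ext x w <= 1.
Proof. by move=> xX; have /andP[] := tail_ext_itv w xX. Qed.

Lemma tail_ext_lt0 x w : w < 0 -> tail_ext x w = 1.
Proof. by rewrite /tail_ext => ->. Qed.

Lemma tail_ext_shift_le x y w d : in_X y ->
  (forall v, 0 <= v -> y (v + d) <= x v) -> 0 <= w -> 0 <= d ->
  forall s, 0 <= s -> tail_ext y (w + d - s) <= tail_ext x (w - s).
Proof.
move=> yX yx w0 d0 s s0; have [ws|sw] := ltP (w - s) 0.
  by rewrite (tail_ext_lt0 _ ws) tail_ext_le1.
rewrite (tail_ext_ge0 x sw) tail_ext_ge0; last lra.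
by rewrite addrAC; exact: yx.
Qed.

Lemma shifted_contact_absurd x y d w1 j0 :
  is_DEFP cls lam p x -> infinite_frame x ->
  is_DEFP cls lam p y -> infinite_frame y ->
  x 0 < 1 -> y 0 < 1 -> 0 < d ->
  (forall w, 0 <= w -> y (w + d) <= x w) -> 0 <= w1 -> y (w1 + d) = x w1 ->
  0 < p j0 -> (0 < width (cls j0))%N -> (0 < mean_size (cls j0))%E -> False.
Proof.
move=> xD xinf yD yinf x01 y01 d0 yx w10 yx1 pj0 d0' mpos.
have al0 := alpha0.
have [xX /(lipschitz_total_load) lx _] := xD.
have [yX /(lipschitz_total_load) ly _] := yD.
have d0l := ltW d0.
pose S := [set u | 0 <= u /\ y (u + d) = x u].
have Sinf : has_inf S by split; [exists w1 | exists 0 => u []].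
pose w' := inf S.
have w'0 : 0 <= w' by apply: lb_le_inf; [exists w1 | move=> u []].
pose phi w := x w + (-1) * y (w + d).
have lphi : lipschitz_ge 0 (2 * alpha) phi.
  move=> u v /andP[u0 uv].
  have /lx H1 : 0 <= u <= v by rewrite u0.
  have /ly H2 : 0 <= u + d <= v + d by rewrite addr_ge0//= lerD2r.
  rewrite (_ : _ - _ = (x v - x u) - (y (v + d) - y (u + d))); last by rewrite /phi; ring.
  apply: le_trans (ler_normB _ _) _.
  move: H2; rewrite (_ : v + d - (u + d) = v - u); last ring.
  lra.
have phi0 w : 0 <= w -> 0 <= phi w by move=> /yx; rewrite /phi; lra.
have phiw' : phi w' <= 0.
  apply/ler_addgt0Pr => e e0; rewrite add0r.
  have M0 : 0 < 2 * alpha + 1 by lra.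
  have [t [t0 xt] tw] := inf_adherent (divr_gt0 e0 M0) Sinf.
  have wt : w' <= t by apply: ge_inf; [exact: Sinf.2|split].
  have := lphi w' t; rewrite w'0 wt => /(_ isT); rewrite ler_norml => /andP[H _].
  have phit : phi t = 0 by rewrite /phi xt; ring.
  have : 2 * alpha * (t - w') <= (2 * alpha + 1) * (e / (2 * alpha + 1)); last first.
    by rewrite [(_ + 1) * _]mulrC divfK ?gt_eqF//; lra.
  apply: le_trans (_ : (2 * alpha + 1) * (t - w') <= _).
    by rewrite ler_wpM2r ?subr_ge0//; lra.
  by rewrite ler_pM2l//; move: tw; rewrite -/w'; lra.
have dphi w : 0 <= w ->
    right_derivative phi w (- rate x w + (-1) * (- rate y (w + d))).
  move=> w0; apply: right_derivative_linear; first exact: DEFP_right_derivative.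
  apply: right_derivative_shift; apply: DEFP_right_derivative => //.
  by rewrite addr_ge0.
(* The crossing rate is Lipschitz in the level, so contact persists to the right. *)
have lephi w : w' <= w -> phi w <= 0.
  apply: (@gronwall_le0 _ phi (fun w => - rate x w + (-1) * (- rate y (w + d)))
    w' (2 * alpha) (alpha + 1)) => //; first by lra.
    by move=> u v /andP[u0 uv]; apply: lphi; rewrite uv (le_trans w'0).
  move=> u wu; have u0 := le_trans w'0 wu; split; first exact: dphi.
  have := @rate_add_cst _ _ cls lam p lam0' p0 y x (u + d) u (phi u) yX xX
    (addr_ge0 u0 d0l) u0 (phi0 _ u0).
  have /[swap] /[apply] : x u <= y (u + d) + phi u by rewrite /phi; lra.
  move=> /(_ (tail_ext_shift_le yX yx u0 d0l)).
  by have := phi0 _ u0; lra.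
have eqw w : w' <= w -> y (w + d) = x w.
  move=> ww; have := lephi _ ww; have := phi0 _ (le_trans w'0 ww).
  by rewrite /phi; lra.
(* This is the reverse of the order given by monotonicity: the difference stays [0] to the right of
   [w']. Together with [rate_gap] it forces the increments to agree. *)
have rates w : w' <= w -> rate x w <= rate y (w + d).
  move=> ww; have w0 := le_trans w'0 ww.
  have := right_derivative_ge0 (dphi w w0) => H.
  suff : 0 <= - rate x w + (-1) * (- rate y (w + d)) by lra.
  by apply: H => v wv; rewrite /phi !eqw ?(le_trans ww)//; lra.
have k0 : (0 < needed (cls j0))%N.
  by have [[/andP[]//|[_ E]] _ _] := vc j0; rewrite E in d0'.
have incs w : w' <= w ->
    mean_increments (cls j0) x w <= mean_increments (cls j0) y (w + d).
  move=> ww; have w0 := le_trans w'0 ww; have wd0 := addr_ge0 w0 d0l.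
  have y0 := infinite_frame_gt0 yX yinf wd0.
  have := @rate_gap _ _ cls lam p lam0' p0 x y w (w + d) (y (w + d)) j0 xX yX w0
    wd0 (ltW y0) (lexx _) (eqw _ ww) k0 (tail_ext_shift_le yX yx w0 d0l).
  move=> H; have := rates w ww => H2.
  have : 0 < lam * p j0 * y (w + d) ^+ width (cls j0).
    by apply: mulr_gt0; [exact: mulr_gt0|exact: exprn_gt0].
  by nra.
(* Equal rates at the levels [W k] exclude sizes in [(0, w' + d]] (minimality of the
   contact [w']) and in each [(W k, W k + d]], hence all positive sizes. *)
pose W k : R := w' + k%:R * d.
have W' k : w' <= W k by rewrite lerDl mulr_ge0.
have W0 k : 0 <= W k := le_trans w'0 (W' k).
pose F k (t : (width (cls j0)).-tuple R) :=
  1 * increment_sum x (W k) t + (-1) * increment_sum y (W k + d) t.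
have FE k t : F k t = \sum_(i <- enum 'I_(width (cls j0)))
    (size_tail x (W k) t i - size_tail y (W k + d) t i).
  rewrite /F mul1r mulN1r /increment_sum -sumrB; apply: eq_bigr => i _.
  by rewrite eqw//; ring.
have term0 k t i : 0 <= size_tail x (W k) t i - size_tail y (W k + d) t i.
  rewrite subr_ge0; apply: tail_ext_shift_le => //.
  by rewrite le_max lexx.
have Wd0 k : 0 <= W k + d by rewrite addr_ge0.
have IF k : (size_law (cls j0)).-integrable setT (EFin \o F k).
  by apply: integrableD_class; apply: integrableZl_class; exact: integrable_increment_sum.
have [||||t [[i ti] Ft]] := @exists_positive_size R (cls j0) F (vc j0) d0' mpos.
- move=> k; apply: measurable_funD; apply: measurable_funM => //;
    exact: measurable_increment_sum.
- by move=> k t; rewrite FE; exact: sumr_ge0.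
- exact: IF.
- move=> k; rewrite Rintegral_linear; [|exact: integrable_increment_sum..].
  by have := incs _ (W' k); rewrite /mean_increments; lra.
have tE k : tail_ext x (W k - tnth t i) = tail_ext y (W k + d - tnth t i).
  have := Ft k; rewrite FE big_enum/= => /eqP.
  rewrite psumr_eq0 => [/allP/(_ i)|l _]; last exact: term0.
  rewrite mem_index_enum => /(_ isT)/=; rewrite subr_eq0 /size_tail.
  by have -> : Num.max 0 (tnth t i) = tnth t i by [exact/max_r/ltW]; move=> /eqP.
pose tau : R := tnth t i; rewrite -/tau in ti tE.
have y1 v : 0 <= v -> tail_ext y v < 1.
  move=> v0; rewrite tail_ext_ge0//; apply: le_lt_trans y01.
  exact: in_X_nonincreasing.
have : exists k, tau <= W k + d.
  exists (Num.bound (tau / d)).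
  have := @archi_boundP _ (tau / d); rewrite divr_ge0 ?(ltW ti)// => /(_ isT).
  by rewrite ltr_pdivrMr// /W; lra.
move=> /ex_minnP[k tk kmin].
(* There the tail of [x] is [1], whereas that of [y] is read at a nonnegative level and lies below
   [1]. *)
have tneg : W k - tau < 0 -> False.
  move=> H; have := tE k; rewrite (tail_ext_lt0 _ H) => E.
  by have := y1 (W k + d - tau); rewrite subr_ge0 -E ltxx => /(_ tk).
(* For [k = 0], a size at most [w'] gives a contact before [w']. For a successor, minimality puts
   [tau] above [W k + d], which is the next level. *)
case: k => [|k] in tk kmin tneg *.
  have [tw|wt] := leP tau w'; last first.
    by apply: tneg; rewrite /W mul0r addr0 subr_lt0.
  have := tE 0%N; rewrite /W mul0r addr0 !tail_ext_ge0; last 2 first.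
  - by rewrite subr_ge0 ler_wpDr.
  - by rewrite subr_ge0.
  move=> E; have : w' <= w' - tau.
    apply: ge_inf; first exact: Sinf.2.
    by split; [rewrite subr_ge0|rewrite E; congr y; ring].
  lra.
apply: tneg; have : ~~ (tau <= W k + d).
  by apply/negP => /kmin; rewrite ltnn.
by rewrite -ltNge /W -natr1; lra.
Qed.

(** * Comparison with a dominating supersolution *)

Section Hat.
(** [ghat] stands for the crossing rate of [z] under the dominating parameters; [slack] is its link
    to the given ones. *)
Context (z ghat : R -> R) (M c : R).
Hypotheses (zX : in_X z) (lz : lipschitz_ge 0 M z) (c0 : 0 < c) (z01 : z 0 < 1).
Hypotheses (dz : forall w, 0 <= w -> right_derivative z w (- ghat w)).
Hypotheses (slack : forall w, 0 <= w -> rate z w + c * total_increments cls z w <= ghat w).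
Hypotheses (Dz : forall w, 0 <= w -> 0 < total_increments cls z w).
Hypotheses (ghat_rc : forall w e, 0 <= w -> 0 < e ->
  exists2 d, 0 < d & forall s, 0 <= s <= d -> `|ghat (w + s) - ghat w| <= e).

(** The constant [a] costs at most [a * alpha] units of increments, less than the slack [c]; and
    [b < a] keeps the shifted [y] away from [z + a] at infinity. *)
Lemma DEFP_le_hat y (a b : R) : is_DEFP cls lam p y -> infinite_frame y ->
  y w @[w --> +oo] --> b -> 0 <= a -> b < a -> a * alpha < c ->
  forall w, 0 <= w -> y w <= z w + a.
Proof.
move=> yD yinf yb a0 ba aac.
have al0 := alpha0.
have [yX /(lipschitz_total_load) ly _] := yD.
have [B B0 yB] : exists2 B, 0 <= B & forall w, B <= w -> y w <= a.
  have [B [_ HB]] : \forall w \near +oo, y w < a by exact: (cvgr_lt b).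
  exists (Num.max 0 (B + 1)); first by rewrite le_max lexx.
  by move=> w; rewrite ge_max => /andP[_ Bw]; apply/ltW/HB; lra.
have lza : lipschitz_ge 0 M (fun w => z w + a).
  move=> u v uv; rewrite (_ : _ - _ = z v - z u); last ring.
  exact: lz.
have az w : 0 <= w -> a <= z w + a.
  by move=> w0; have /andP[? _] := in_X_itv zX w0; lra.
have [d [d0 H C]] := exists_contact B0 (lexx 0) ly lza yB az.
case: C => [dE|[w1 w10 E]].
  by move=> w /H; rewrite dE addr0.
exfalso; have w1d0 : 0 <= w1 + d by exact: addr_ge0.
have : 0 <= (- ghat w1 + 1 * 0) + (-1) * (- rate y (w1 + d)).
  apply: (@right_derivative_ge0 _ (fun v => (z v + 1 * a) + (-1) * y (v + d)) w1).
    apply: right_derivative_linear.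
      by apply: right_derivative_linear; [exact: dz|exact: right_derivative_cst].
    by apply: right_derivative_shift; exact: DEFP_right_derivative.
  move=> v wv; have := H v (le_trans w10 wv); rewrite E; lra.
have tailb s : 0 <= s -> tail_ext y (w1 + d - s) <= tail_ext z (w1 - s) + a.
  move=> s0; have [ws|sw] := ltP (w1 - s) 0.
    by rewrite (tail_ext_lt0 _ ws); have := tail_ext_le1 (w1 + d - s) yX; lra.
  rewrite (tail_ext_ge0 z sw) tail_ext_ge0; last lra.
  by rewrite addrAC; exact: H.
have := @rate_compare _ _ cls lam p lam0' p0 y z z (w1 + d) w1 w1 1 0 a a
  yX zX zX w1d0 w10 w10 ler01 (lexx _) a0 a0.
rewrite mul1r mul0r addr0 E => /(_ _ tailb tailb) H1.
have : rate y (w1 + d) <= rate z w1 + a * alpha * total_increments cls z w1.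
  by apply: H1 => s /tailb; rewrite mul1r mul0r addr0; lra.
have := slack w10.
have : a * alpha * total_increments cls z w1 < c * total_increments cls z w1.
  by rewrite ltr_pM2r// Dz.
lra.
Qed.

(** A bootstrap: if [C * z - x] is nonincreasing up to [w], the past increments of [x] are at most
    [C] times those of [z]. So the rate of [x] at [w] is strictly below [C * ghat w], and
    monotonicity continues beyond [w]. *)
Lemma DEFP_increments_le_hat x (a : R) : is_DEFP cls lam p x -> infinite_frame x ->
  x 0 < 1 -> 0 <= a -> a * alpha < c -> (forall w, 0 <= w -> x w <= z w + a) ->
  forall u v, 0 <= u -> u <= v ->
    x u - x v <= (1 - x 0) / (1 - z 0) * (z u - z v).
Proof.
move=> xD xinf x01 a0 aac xz.
have al0 := alpha0.
have [xX /(lipschitz_total_load) lx _] := xD.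
pose C := (1 - x 0) / (1 - z 0).
have C0 : 0 < C by rewrite divr_gt0// subr_gt0.
have CE : C * (1 - z 0) = 1 - x 0 by rewrite /C divfK// subr_eq0 gt_eqF.
pose F w := 0 + C * z w + (-1) * x w.
have lF : lipschitz_ge 0 (C * `|M| + alpha) F.
  move=> u v uv; have Hz := lz uv; have Hx := lx _ _ uv.
  rewrite (_ : _ - _ = C * (z v - z u) - (x v - x u)); last by rewrite /F; ring.
  apply: le_trans (ler_normB _ _) _; rewrite normrM (gtr0_norm C0) mulrDl.
  apply: lerD => //; rewrite -[leRHS]mulrA ler_pM2l//; apply: le_trans Hz _.
  have /andP[_ uv'] := uv.
  by rewrite ler_wpM2r ?subr_ge0// ler_norm.
have lFr u' : 0 <= u' -> lipschitz_ge u' (C * `|M| + alpha) F.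
  by move=> u'0 u v /andP[u'u uv]; apply: lF; rewrite uv (le_trans u'0).
have dF w : 0 <= w ->
    right_derivative F w (0 + C * (- ghat w) + (-1) * (- rate x w)).
  move=> w0; apply: right_derivative_linear; last exact: DEFP_right_derivative.
  by apply: right_derivative_linear; [exact: right_derivative_cst|exact: dz].
(* [C] matches the jumps at [0] of the two tails extended by [1]. *)
suff H w : 0 <= w -> forall u, 0 <= u <= w -> F w <= F u.
  move=> u v u0 uv; have := H v (le_trans u0 uv) u.
  by rewrite u0 uv => /(_ isT); rewrite /F -/C; lra.
move: w; apply: real_induction.
- by move=> u u0; rewrite (_ : u = 0)//; apply/le_anti; rewrite andbC.
- move=> w w0 Pw.
  have Fle u : 0 <= u -> u <= w -> F w <= F u.
    by move=> u0 uw; apply: Pw; rewrite ?w0 ?lexx// u0.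
  have tailz s : 0 <= s -> tail_ext x (w - s) <= tail_ext z (w - s) + a.
    move=> s0; have [ws|sw] := ltP (w - s) 0.
      by rewrite !(tail_ext_lt0 _ ws); lra.
    by rewrite !tail_ext_ge0//; exact: xz.
  have incz s : 0 <= s -> tail_ext x (w - s) - x w <= C * (tail_ext z (w - s) - z w).
    move=> s0; have [ws|sw] := ltP (w - s) 0.
      rewrite !(tail_ext_lt0 _ ws).
      by have := Fle 0 (lexx _) w0; rewrite /F; lra.
    rewrite !tail_ext_ge0//.
    by have := Fle (w - s) sw; rewrite gerBl s0 => /(_ isT); rewrite /F; lra.
  have := @rate_compare _ _ cls lam p lam0' p0 x z z w w w C 0 a a
    xX zX zX w0 w0 w0 (ltW C0) (lexx _) a0 a0.
  rewrite mul0r addr0 => /(_ _ tailz tailz) H1.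
  have {}H1 : rate x w <= C * (rate z w + a * alpha * total_increments cls z w).
    by apply: H1 => s /incz; rewrite mul0r addr0.
  pose D := total_increments cls z w; have D0 : 0 < D := Dz w0.
  pose gap := C * ((c - a * alpha) * D).
  have gap0 : 0 < gap.
    by apply: mulr_gt0 => //; apply: mulr_gt0 => //; rewrite subr_gt0.
  have H2 : rate x w + gap <= C * ghat w.
    apply: le_trans (_ : C * (rate z w + c * D) <= _); last first.
      by rewrite ler_pM2l// slack.
    by rewrite /gap -/D in H1 *; lra.
  (* Half of the gap is spent on the variation of the rate of [x], half on that of [C * ghat]. *)
  have [d1 d10 Hx] := rate_right_continuous cls lam p xX w0
    (divr_gt0 gap0 (ltr0n R 2)).
  have [d2 d20 Hz] := ghat_rc w0 (divr_gt0 (divr_gt0 gap0 (ltr0n R 2)) C0).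
  exists (Num.min d1 d2); first by rewrite lt_min d10.
  move=> v /andP[wv vd] u /andP[u0 uv].
  have vd1 : v <= w + d1 by apply: le_trans vd _; rewrite lerD2l ge_min lexx.
  have vd2 : v <= w + d2 by apply: le_trans vd _; rewrite lerD2l ge_min lexx orbT.
  have right u' v' : w <= u' -> u' <= v' -> v' <= v -> F v' <= F u'.
    move=> wu uv' vv; have u'0 := le_trans w0 wu.
    apply: (right_derivative_nonincreasing uv' (lFr _ u'0)
      (l := fun t => 0 + C * (- ghat t) + (-1) * (- rate x t))).
    move=> t /andP[ut tv]; have t0 := le_trans u'0 ut; split; first exact: dF.
    have := Hx (t - w); have := Hz (t - w); rewrite subrKC.
    have -> : 0 <= t - w <= d1 by apply/andP; split; lra.
    have -> : 0 <= t - w <= d2 by apply/andP; split; lra.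
    move=> /(_ isT); rewrite ler_norml => /andP[h1 _].
    move=> /(_ isT); rewrite ler_norml => /andP[_ h2].
    have := ler_wpM2l (ltW C0) h1.
    rewrite mulrN [C * (_ / C)]mulrC divfK ?gt_eqF//; lra.
  have [uw|wu] := leP u w; last by apply: right => //; exact: ltW.
  by apply: le_trans (Fle u u0 uw); exact: right.
- move=> w w0 Pw u /andP[u0]; rewrite le_eqVlt => /predU1P[->//|uw].
  apply: (le_limit_left (lFr _ u0) uw) => v /andP[uv vw].
  by apply: Pw; rewrite ?u0//= (le_trans u0).
Qed.
(** Equal limits leave no room at infinity; [t * q >= t] creates some, and then [t] tends to [0].
    The threshold [w1] does not depend on the shift, so only contacts in [[0, w1]] remain to be
    studied. *)
Lemma DEFP_tail_domination x y (a b : R) :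
  is_DEFP cls lam p x -> infinite_frame x -> x w @[w --> +oo] --> b -> x 0 < 1 ->
  is_DEFP cls lam p y -> infinite_frame y -> y w @[w --> +oo] --> b ->
  0 <= a -> a * alpha <= c / 4 -> (forall w, 0 <= w -> x w <= z w + a) ->
  exists2 w1, 0 <= w1 & forall d0, 0 <= d0 ->
    (forall w, 0 <= w <= w1 -> y (w + d0) <= x w) ->
    forall w, 0 <= w -> y (w + d0) <= x w.
Proof.
move=> xD xinf xb x01 yD yinf yb a0 aac xz.
have al0 := alpha0; have c0' := c0.
have [xX /(lipschitz_total_load) lx _] := xD.
have [yX /(lipschitz_total_load) ly _] := yD.
pose C := (1 - x 0) / (1 - z 0).
have C0 : 0 < C by rewrite divr_gt0// subr_gt0.
have CE : C * (1 - z 0) = 1 - x 0 by rewrite /C divfK// subr_eq0 gt_eqF.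
have xzC u v : 0 <= u -> u <= v -> x u - x v <= C * (z u - z v).
  by move=> u0 uv; apply: (DEFP_increments_le_hat xD xinf x01 a0) => //; lra.
(* In units of [t * D], the errors are at most [2 * alpha * C] from [x] and [A * c / 2] from [z];
   this [A] makes their sum less than the slack [A * c]. *)
pose A := 4 * alpha * C / c + 1.
have A0 : 0 < A.
  apply: ltr_wpDl => //; apply: divr_ge0; last exact: ltW.
  by apply: mulr_ge0; [exact: mulr_ge0|exact: ltW].
have Ac : A * c = 4 * alpha * C + c by rewrite mulrDl mul1r divfK ?gt_eqF.
(* Beyond [w1] the remaining decrease of [z], multiplied by [A], is at most [1]; this keeps [q]
   above [1]. *)
have [w1 w10 zw1] : exists2 w1, 0 <= w1 & forall w, w1 <= w -> z w1 - z w <= A^-1.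
  pose S := [set z w | w in [set w | 0 <= w]].
  have Sinf : has_inf S.
    split; first by exists (z 0); exists 0 => //=.
    by exists 0 => _ [w /= w0 <-]; have /andP[] := in_X_itv zX w0.
  have iA0 : 0 < A^-1 by rewrite invr_gt0.
  have [_ [w1 /= w10 <-] zw1] := inf_adherent iA0 Sinf.
  exists w1 => // w ww; rewrite lerBlDl -lerBlDr.
  rewrite lerBlDr; apply: le_trans (ltW zw1) _; rewrite lerD2r.
  by apply: ge_inf; [exact: Sinf.2|exists w => //=; exact: le_trans ww].
exists w1 => // d0 d00 yx1.
(* Freezing [q] below [w1] keeps it in [[1, 2]]; only beyond [w1] must [x + t q]
   be a supersolution. *)
pose q v := 2 + A * (z (Num.max v w1) - z w1).
have q12 v : 0 <= v -> 1 <= q v <= 2.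
  move=> v0; have m1 : w1 <= Num.max v w1 by rewrite le_max lexx orbT.
  have := zw1 _ m1; have := in_X_nonincreasing zX w10 m1 => h1 h2.
  have := ler_wpM2l (ltW A0) h2; rewrite divff ?gt_eqF// => h3.
  have : A * (z (Num.max v w1) - z w1) <= 0 by rewrite mulr_ge0_le0 ?(ltW A0)// subr_le0.
  by rewrite /q => h4; apply/andP; split; lra.
have max_lip (u v : R) : u <= v -> 0 <= Num.max v w1 - Num.max u w1 <= v - u.
  by move=> uv; rewrite /Num.max; case: ifPn; case: ifPn; rewrite -?leNgt; lra.
have xb' w : 0 <= w -> b <= x w.
  move=> w0; rewrite leNgt; apply/negP => xwb.
  have [B [_ HB]] : \forall v \near +oo, x w < x v by exact: (cvgr_gt b).
  have := HB (Num.max (B + 1) w); rewrite lt_max ltrDl ltr01 => /(_ isT).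
  rewrite ltNge; apply/negP; rewrite negbK.
  by apply: in_X_nonincreasing => //; rewrite le_max lexx orbT.
(* This gives [2 * t * alpha <= c / 4], hence [(a + 2 * t) * alpha <= c / 2]. *)
pose t0 := c / (8 * (alpha + 1)).
have t00 : 0 < t0 by rewrite divr_gt0//; lra.
suff H t : 0 < t -> t <= t0 -> forall w, 0 <= w -> y (w + d0) <= x w + t * q w.
  move=> w w0; apply/ler_addgt0Pr => e e0.
  pose t := Num.min t0 (e / 2).
  have t'0 : 0 < t by rewrite lt_min t00 divr_gt0.
  have := H t t'0; rewrite ge_min lexx => /(_ isT w w0).
  have /andP[_ qw] := q12 w w0.
  have : t <= e / 2 by rewrite ge_min lexx orbT.
  have := ler_wpM2l (ltW t'0) qw; lra.
move=> t'0 tt0.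
have talpha : 2 * t * alpha <= c / 4.
  apply: le_trans (_ : 2 * t0 * (alpha + 1) <= _).
    have := ler_wpM2r al0 tt0; have : 0 <= t0 by exact: ltW.
    lra.
  rewrite le_eqVlt; apply/orP; left; apply/eqP; rewrite /t0; field.
  by rewrite gt_eqF//; lra.
have lxq : lipschitz_ge 0 (alpha + t * (A * `|M|)) (fun w => x w + t * q w).
  move=> u v uv; have /andP[u0 uv'] := uv.
  have /andP[m1 m2] := max_lip _ _ uv'.
  have Hx := lx _ _ uv.
  have Hz : `|z (Num.max v w1) - z (Num.max u w1)| <= `|M| * (v - u).
    apply: le_trans (_ : M * (Num.max v w1 - Num.max u w1) <= _).
      by apply: lz; apply/andP; split; [rewrite le_max u0|rewrite -subr_ge0].
    apply: le_trans (_ : `|M| * (Num.max v w1 - Num.max u w1) <= _).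
      by rewrite ler_wpM2r// ler_norm.
    by rewrite ler_wpM2l.
  rewrite (_ : _ - _ = (x v - x u) + t * (A * (z (Num.max v w1) - z (Num.max u w1))));
    last by rewrite /q; ring.
  apply: le_trans (ler_normD _ _) _; rewrite [leRHS]mulrDl; apply: lerD => //.
  rewrite !normrM (gtr0_norm t'0) (gtr0_norm A0) -[leRHS]mulrA ler_pM2l//.
  by rewrite -[leRHS]mulrA ler_pM2l.
have [B B0 yB] : exists2 B, 0 <= B & forall w, B <= w -> y w <= b + t.
  have [B [_ HB]] : \forall w \near +oo, y w < b + t.
    by apply: (cvgr_lt b) => //; rewrite ltrDl.
  exists (Num.max 0 (B + 1)); first by rewrite le_max lexx.
  by move=> w; rewrite ge_max => /andP[_ Bw]; apply/ltW/HB; lra.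
have bt w : 0 <= w -> b + t <= x w + t * q w.
  move=> w0; have := xb' w w0; have /andP[qw _] := q12 w w0.
  by have := ler_wpM2l (ltW t'0) qw; lra.
have [d [d0d H CC]] := exists_contact B0 d00 ly lxq yB bt.
case: CC => [<-//|[w w0 E]].
have d'0 := le_trans d00 d0d.
(* Up to [w1] the assumed order leaves the full gap [t * q w]; no differential argument is needed
   there. *)
exfalso; have [ww1|w1w] := leP w w1.
  have /yx1 H1 : 0 <= w <= w1 by rewrite w0.
  have H2 : y (w + d) <= y (w + d0).
    by apply: in_X_nonincreasing => //; [exact: addr_ge0|rewrite lerD2l].
  have /andP[qw _] := q12 w w0.
  have := mulr_gt0 t'0 (lt_le_trans ltr01 qw); lra.
have wd0 : 0 <= w + d by exact: addr_ge0.
have qE v : w1 <= v -> q v = 2 + A * (z v - z w1).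
  by move=> wv; rewrite /q; congr (_ + _ * (z _ - _)); exact/max_l.
pose G v := x v + t * A * (z v + 1 * (2 / A - z w1)) + (-1) * y (v + d).
have GE v : w1 <= v -> G v = x v + t * q v + (-1) * y (v + d).
  by move=> wv; rewrite /G qE//; field; rewrite gt_eqF.
have dG : 0 <= (- rate x w + t * A * (- ghat w + 1 * 0)) + (-1) * (- rate y (w + d)).
  apply: (@right_derivative_ge0 _ G w).
    apply: right_derivative_linear.
      apply: right_derivative_linear; first exact: DEFP_right_derivative.
      by apply: right_derivative_linear; [exact: dz|exact: right_derivative_cst].
    by apply: right_derivative_shift; exact: DEFP_right_derivative.
  move=> v wv; have w1v := le_trans (ltW w1w) wv.
  rewrite !GE// ?(ltW w1w)//; have := H v (le_trans w0 wv); rewrite E; lra.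
have tail1 s : 0 <= s -> tail_ext y (w + d - s) <= tail_ext x (w - s) + 2 * t.
  move=> s0; have [ws|sw] := ltP (w - s) 0.
    by rewrite (tail_ext_lt0 _ ws); have := tail_ext_le1 (w + d - s) yX; lra.
  rewrite (tail_ext_ge0 x sw) tail_ext_ge0; last lra.
  rewrite addrAC; apply: le_trans (H _ sw) _.
  by have /andP[_ qw] := q12 _ sw; have := ler_wpM2l (ltW t'0) qw; lra.
have tail2 s : 0 <= s -> tail_ext y (w + d - s) <= tail_ext z (w - s) + (a + 2 * t).
  move=> s0; apply: le_trans (tail1 s s0) _.
  have [ws|sw] := ltP (w - s) 0; first by rewrite !(tail_ext_lt0 _ ws); lra.
  by rewrite !tail_ext_ge0//; have := xz _ sw; lra.
have zle u v : 0 <= u -> u <= v -> z v <= z u by exact: in_X_nonincreasing.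
have inc s : 0 <= s -> tail_ext y (w + d - s) - y (w + d) <=
    1 * (tail_ext x (w - s) - x w) + t * A * (tail_ext z (w - s) - z w).
  move=> s0; rewrite E qE ?(ltW w1w)//; have [ws|sw] := ltP (w - s) 0.
    rewrite !(tail_ext_lt0 _ ws); have := tail_ext_le1 (w + d - s) yX.
    have /andP[qw _] := q12 w w0; rewrite qE ?(ltW w1w)// in qw.
    have : 0 <= t * A * (1 - z w).
      rewrite mulr_ge0//; first by rewrite mulr_ge0 ?ltW.
      by rewrite subr_ge0; have /andP[] := in_X_itv zX w0.
    have := mulr_gt0 t'0 (lt_le_trans ltr01 qw); lra.
  rewrite (tail_ext_ge0 x sw) (tail_ext_ge0 z sw) tail_ext_ge0; last lra.
  rewrite [w + d - s]addrAC; have := H _ sw; rewrite /q.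
  have : z (Num.max (w - s) w1) <= z (w - s) by apply: zle => //; rewrite le_max lexx.
  have tA : 0 <= t * A by rewrite mulr_ge0 ?ltW.
  by move=> /(ler_wpM2l tA); lra.
have tA0 : 0 < t * A by exact: mulr_gt0.
have at0 : 0 <= a + 2 * t by lra.
have t2 : 0 <= 2 * t by lra.
have := @rate_compare _ _ cls lam p lam0' p0 y x z (w + d) w w 1 (t * A) (2 * t) (a + 2 * t)
  yX xX zX wd0 w0 w0 ler01 (ltW tA0) t2 at0 inc tail1 tail2.
have DxDz : total_increments cls x w <= C * total_increments cls z w.
  rewrite /total_increments mulr_sumr; apply: ler_sum => j _.
  apply: mean_increments_le => // [|s s0]; first exact: ltW.
  have [ws|sw] := ltP (w - s) 0.
    rewrite !(tail_ext_lt0 _ ws).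
    by have := xzC 0 w (lexx _) w0; lra.
  by rewrite !tail_ext_ge0//; apply: xzC => //; rewrite gerBl.
pose D := total_increments cls z w; rewrite -/D in DxDz *.
have D0 : 0 < D := Dz w0.
have slack' : t * A * (rate z w + c * D) <= t * A * ghat w.
  by rewrite ler_pM2l//; exact: slack.
have e1 : 2 * t * alpha * total_increments cls x w <= 2 * t * alpha * (C * D).
  by apply: ler_wpM2l => //; exact: mulr_ge0.
have e2 : t * A * ((a + 2 * t) * alpha * D) <= t * A * (c / 2 * D).
  by rewrite ler_pM2l// ler_pM2r//; lra.
have e3 : t * D * (A * c) = t * D * (4 * alpha * C + c) by rewrite Ac.
have e4 : 0 < t * D * c by apply: mulr_gt0 => //; exact: mulr_gt0.
move=> K; lra.
Qed.

Lemma DEFP_unique x y (a b : R) j0 :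
  is_DEFP cls lam p x -> infinite_frame x -> x w @[w --> +oo] --> b -> x 0 < 1 ->
  is_DEFP cls lam p y -> infinite_frame y -> y w @[w --> +oo] --> b -> y 0 < 1 ->
  (forall w, 0 <= w -> b < x w) ->
  0 < p j0 -> (0 < width (cls j0))%N -> (0 < mean_size (cls j0))%E ->
  0 <= a -> b < a -> a * alpha <= c / 4 ->
  forall w, 0 <= w -> y w <= x w.
Proof.
move=> xD xinf xb x01 yD yinf yb y01 bx pj0 dj0 mpos a0 ba aac w w0.
have al0 := alpha0; have c0' := c0.
have [xX /(lipschitz_total_load) lx _] := xD.
have [yX /(lipschitz_total_load) ly _] := yD.
have xz : forall w, 0 <= w -> x w <= z w + a.
  by apply: (DEFP_le_hat xD xinf xb a0 ba); lra.
have [w1 w10 dom] := DEFP_tail_domination xD xinf xb x01 yD yinf yb a0 aac xz.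
(* The strict inequality [b < x w1] provides a shift that puts [y] below [x] on [[0, w1]]; from it
   the shift is decreased. *)
have [B B0 yB] : exists2 B, 0 <= B & y B <= x w1.
  have [B [_ HB]] : \forall w \near +oo, y w < x w1 by apply: (cvgr_lt b) => //; exact: bx.
  exists (Num.max 0 (B + 1)); first by rewrite le_max lexx.
  by apply/ltW/HB; rewrite lt_max ltrDl ltr01 orbT.
have [||d [d0 H C]] := @exists_contact_itv _ y x _ _ w1 0 B w10 _ ly lx.
- by rewrite lexx.
- move=> v /andP[v0 vw1]; apply: le_trans (in_X_nonincreasing xX v0 vw1).
  by apply: le_trans yB; apply: in_X_nonincreasing => //; rewrite lerDr.
have yx := dom d d0 H.
case: C => [dE|[v /andP[v0 _] E]]; first by have := yx w w0; rewrite dE addr0.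
move: d0; rewrite le_eqVlt => /predU1P[dE|dpos].
  by have := yx w w0; rewrite -dE addr0.
by case: (shifted_contact_absurd xD xinf yD yinf x01 y01 dpos yx v0 E pj0 dj0 mpos).
Qed.

End Hat.
End Comparison.

Theorem theorem15p1 (R : realType) (J : finType) (cls : J -> job_class R)
    (lam : R) (p : J -> R)
    (Hvalid : forall j, valid_class (cls j))
    (Hclosed : closed_under_sub_classes cls)
    (Hmean : nonempty_classes_mean cls)
    (Hlam : 0 < lam)
    (Hp : is_distribution p)
    (Hnondeg : some_class_not_instant cls p)
    (Hhat : exists (lamhat : R) (phat : J -> R),
      [/\ is_distribution phat,
          (forall j, 0 < phat j),
          (forall j, lam * p j < lamhat * phat j) &
          exists xhat : R -> R,
            [/\ is_DEFP cls lamhat phat xhat,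
                infinite_frame xhat &
                ~ (forall w, 0 <= w -> xhat w = 1)]]) :
  exists2 eps : R, 0 < eps &
    forall b : R, 0 <= b < eps ->
    forall x y : R -> R,
      is_DEFP cls lam p x -> infinite_frame x -> x w @[w --> +oo] --> b ->
      is_DEFP cls lam p y -> infinite_frame y -> y w @[w --> +oo] --> b ->
      forall w, 0 <= w -> x w = y w.
Proof.
have [p0 _] := Hp.
have [j0 pj0 nz] := Hnondeg.
(* An empty class needs no completions, so its event of enough zero sizes would be certain. *)
have dj0 : (0 < width (cls j0))%N.
  rewrite lt0n; apply/eqP => d0; have [[/andP[k0 kd]|[k0 _]] _ _] := Hvalid j0.
    by rewrite d0 leqNgt k0 in kd.
  move: nz; rewrite /prob_enough_zeros k0 (_ : [set _ | _] = setT).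
    by rewrite probability_setT ltxx.
  by apply/seteqP; split.
have [mpos _] := Hmean j0 dj0.
have k0 : (0 < needed (cls j0))%N.
  by have [[/andP[]//|[_ E]] _ _] := Hvalid j0; rewrite E in dj0.
have [lamhat [phat [_ phat0 lthat [z [zD zinf nz1]]]]] := Hhat.
have phat0' j : 0 <= phat j by exact: ltW.
have lamhat0 : 0 < lamhat.
  rewrite -(pmulr_lgt0 _ (phat0 j0)); apply: le_lt_trans (lthat j0).
  by rewrite mulr_ge0 ?(ltW Hlam).
have [c c0 slack] := rate_slack j0 Hvalid Hclosed lthat.
have [zX zl _] := zD.
have zlt1 := DEFP_lt1 (ltW lamhat0) phat0' Hvalid zD zinf nz1.
have lz := lipschitz_total_load zl.
have lam0 := ltW Hlam.
have al0 : 0 <= total_load cls lam p by exact: total_load_ge0.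
have dz w : 0 <= w -> right_derivative z w (- rate cls lamhat phat z w).
  move=> w0; exact (DEFP_right_derivative (ltW lamhat0) phat0' Hvalid zD zinf w0).
have slackz w : 0 <= w ->
    rate cls lam p z w + c * total_increments cls z w <= rate cls lamhat phat z w.
  exact: slack.
have Dz w : 0 <= w -> 0 < total_increments cls z w.
  move=> w0.
  (* The slack alone already bounds the decay of [z] from below by [c] times the increments of class
     [j0]. *)
  have [|D0 _] := @strictly_decreasing R z (cls j0) _ (fun=> c) _ zX lz
    (zlt1 0 (lexx _)) (Hvalid j0) dj0 mpos dz _ w w0.
    move=> v v0; split => //; apply: le_trans (slackz v v0).
    apply: ler_wpDl; first exact: rate_ge0.
    by rewrite ler_pM2l//; exact: mean_increments_le_total.
  by apply: lt_le_trans D0 _; exact: mean_increments_le_total.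
have ghat_rc w e : 0 <= w -> 0 < e -> exists2 d, 0 < d & forall s, 0 <= s <= d ->
    `|rate cls lamhat phat z (w + s) - rate cls lamhat phat z w| <= e.
  exact: rate_right_continuous.
(* Chosen so that [a * alpha <= c / 4]; the other quarter allotted to tail errors goes to
   [2 * t * alpha]. *)
pose a := c / (4 * (total_load cls lam p + 1)).
have den0 : 0 < 4 * (total_load cls lam p + 1) by lra.
have a0 : 0 < a by exact: divr_gt0.
have aac : a * total_load cls lam p <= c / 4.
  apply: le_trans (_ : a * (total_load cls lam p + 1) <= _).
    by rewrite ler_pM2l//; lra.
  rewrite le_eqVlt; apply/orP; left; apply/eqP; rewrite /a; field.
  by rewrite gt_eqF//; lra.
(* [b < a] serves the comparison with [z + a]; [b < 1] excludes the constant DE-FP [1]. *)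
exists (Num.min a 1) => [|b /andP[b0]]; first by rewrite lt_min a0 ltr01.
rewrite lt_min => /andP[ba b1] x y xD xinf xb yD yinf yb.
have lt1 u : is_DEFP cls lam p u -> infinite_frame u -> u w @[w --> +oo] --> b ->
    u 0 < 1.
  move=> uD uinf ub; apply: (DEFP_lt1 lam0 p0 Hvalid uD uinf) => // u1.
  have [B [_ HB]] : \forall w \near +oo, u w < 1 by exact: (cvgr_lt b).
  have := HB (Num.max (B + 1) 0); rewrite lt_max ltrDl ltr01 => /(_ isT).
  by rewrite u1 ?ltxx// le_max lexx orbT.
have gtb u : is_DEFP cls lam p u -> infinite_frame u -> u w @[w --> +oo] --> b ->
    forall w, 0 <= w -> b < u w.
  move=> uD uinf ub w w0; have [uX ul _] := uD.
  have [|_ dec] := @strictly_decreasing R u (cls j0) (rate cls lam p u)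
      (fun v => lam * p j0 * u v ^+ width (cls j0)) _ uX (lipschitz_total_load ul)
      (lt1 _ uD uinf ub) (Hvalid j0) dj0 mpos
      (fun w => DEFP_right_derivative lam0 p0 Hvalid uD uinf (w := w)) _ w w0.
    move=> v v0; split; last exact: rate_ge.
    apply: mulr_gt0; first exact: mulr_gt0.
    by apply: exprn_gt0; exact: infinite_frame_gt0.
  apply: le_lt_trans (dec (w + 1) _); last by rewrite ltrDl.
  rewrite leNgt; apply/negP => uwb.
  have [B [_ HB]] : \forall v \near +oo, u (w + 1) < u v by exact: (cvgr_gt b).
  have := HB (Num.max (B + 1) (w + 1)); rewrite lt_max ltrDl ltr01 => /(_ isT).
  rewrite ltNge; apply/negP; rewrite negbK.
  apply: in_X_nonincreasing => //; first by rewrite addr_ge0.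
  by rewrite le_max lexx orbT.
have le_sol u v : is_DEFP cls lam p u -> infinite_frame u -> u w @[w --> +oo] --> b ->
    is_DEFP cls lam p v -> infinite_frame v -> v w @[w --> +oo] --> b ->
    forall w, 0 <= w -> v w <= u w.
  move=> uD uinf ub vD vinf vb.
  apply: (DEFP_unique Hvalid Hlam p0 zX lz c0 (zlt1 0 (lexx _)) dz slackz Dz ghat_rc
    uD uinf ub (lt1 _ uD uinf ub) vD vinf vb (lt1 _ vD vinf vb) (gtb _ uD uinf ub)
    pj0 dj0 mpos (ltW a0) ba aac).
by move=> w w0; apply/le_anti; rewrite !le_sol.
Qed.
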